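(* Let $0<\alpha,\beta,\gamma<2$ with $\alpha\beta\gamma<2$, let $\mu$ be any complex number, let $\varepsilon>0$, and let $\eta$ be a real number satisfying $$\frac{\pi\alpha\beta\gamma}{2}<\eta\le\min(\pi,\pi\alpha\beta\gamma).$$ Put $$\varepsilon_\alpha:=\varepsilon^{\frac1{\beta\gamma}},\quad \varepsilon_\beta:=\varepsilon^{\frac1{\alpha\gamma}},\quad \varepsilon_\gamma:=\varepsilon^{\frac1{\alpha\beta}},\quad \eta_\alpha:=\frac{\eta}{\beta\gamma},\quad \eta_\beta:=\frac{\eta}{\alpha\gamma},\quad \eta_\gamma:=\frac{\eta}{\alpha\beta}.$$ If $x\in\Omega^{(-)}(\varepsilon_\alpha;\eta_\alpha)$, $y\in\Omega^{(-)}(\varepsilon_\beta;\eta_\beta)$ and $z\in\Omega^{(-)}(\varepsilon_\gamma;\eta_\gamma)$, then $$E_{\alpha,\beta,\gamma}(x,y,z;\mu)=\frac{1}{2\pi i}\,\frac{1}{\alpha\beta\gamma}\int_{\omega(\varepsilon;\eta)}\frac{e^{s^{1/(\alpha\beta\gamma)}}\,s^{\frac{\alpha+\beta+\gamma+1-\mu}{\alpha\beta\gamma}-1}}{\left(s^{1/(\beta\gamma)}-x\right)\left(s^{1/(\alpha\gamma)}-y\right)\left(s^{1/(\alpha\beta)}-z\right)}\,ds.$$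
   Context: The three-variable Mittag-Leffler function is $$E_{\alpha,\beta,\gamma}(x,y,z;\mu)=\sum_{n,m,p=0}^{\infty}\frac{x^n y^m z^p}{\Gamma(n\alpha+m\beta+p\gamma+\mu)},\qquad \alpha,\beta,\gamma>0,\ \mu,x,y,z\in\mathbb{C},$$ with $1/\Gamma$ understood as the entire reciprocal Gamma function (zero at the poles of $\Gamma$). Hankel contour: for $\varepsilon>0$ and $\eta>0$, $\omega(\varepsilon;\eta)$ is the path, oriented in the direction of non-decreasing $\arg s$, consisting of the two rays $S_{\pm\eta}=\{\arg s=\pm\eta,\ |s|\ge\varepsilon\}$ and the circular arc $\{|s|=\varepsilon,\ -\eta\le\arg s\le\eta\}$. That is, it comes in from infinity along $\arg s=-\eta$, follows the arc counterclockwise, and goes out to infinity along $\arg s=\eta$. If $\eta=\pi$ it is the keyhole path around the negative real axis, i.e. the ray $(-\infty,-\varepsilon]$ traversed in both directions (with $\arg s=-\pi$ incoming and $\arg s=\pi$ outgoing) together with the circle $|s|=\varepsilon$. For $0<\eta<\pi$ the contour divides the complex plane into two unbounded regions, $\Omega^{(-)}(\varepsilon;\eta)$ to the left of the contour and $\Omega^{(+)}(\varepsilon;\eta)$ to the right. Explicitly, with $\arg s\in(-\pi,\pi]$, $\Omega^{(-)}(\varepsilon;\eta)=\{|s|<\varepsilon\}\cup\{s\neq0:\ |\arg s|>\eta\}$ and $\Omega^{(+)}(\varepsilon;\eta)=\{|s|>\varepsilon,\ |\arg s|<\eta\}$; these formulas are used as the definition also when $\eta\ge\pi$. In contour integrals,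 powers are $s^a=\exp(a(\ln|s|+i\arg s))$ with $\arg s\in[-\eta,\eta]$ the argument along the contour. *)

(* Defs.v *)
From Stdlib Require Import Reals Factorial.
From Coquelicot Require Import Coquelicot.

Open Scope R_scope.

Definition Cexp (z : C) : C :=
  (exp (Re z) * cos (Im z), exp (Re z) * sin (Im z)).

(** Principal argument, in (-PI, PI]; meaningful for [z <> 0] only. *)
Definition Carg (z : C) : R :=
  if Rlt_dec (Im z) 0 then - acos (Re z / Cmod z) else acos (Re z / Cmod z).

(** Like Coquelicot's [Lim_seq], this is meaningful when the sequence converges. *)
Definition C_lim_seq (u : nat -> C) : C :=
  (real (Lim_seq (fun n => Re (u n))), real (Lim_seq (fun n => Im (u n)))).

Fixpoint rising (z : C) (n : nat) : C :=
  match n with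
  | O => 1
  | S k => (rising z k * (z + INR k))%C
  end.

(** Euler-Gauss limit  1/Gamma(z) = lim_n  z (z+1) ... (z+n) / (n! n^z).
    It converges for every complex [z], to an entire function that vanishes
    exactly at 0, -1, -2, ... *)
Definition rGamma (z : C) : C :=
  C_lim_seq (fun n =>
    (rising z (S n) / (INR (fact n) * Cexp (z * ln (INR n))))%C).

Definition cube_sum {G : AbelianMonoid} (a : nat -> nat -> nat -> G) (N : nat) : G :=
  sum_n (fun n => sum_n (fun m => sum_n (fun p => a n m p) N) N) N.

Definition abs_summable3 (a : nat -> nat -> nat -> C) : Prop :=
  exists M : R, forall N : nat, cube_sum (fun n m p => Cmod (a n m p)) N <= M.

(** For an absolutely summable family the order of summation is irrelevant;
    the sum is taken here as the limit over cubes. *)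
Definition sum3 (a : nat -> nat -> nat -> C) : C :=
  C_lim_seq (cube_sum a).

Definition ML3_term (alpha beta gamma : R) (x y z mu : C) (n m p : nat) : C :=
  (x ^ n * y ^ m * z ^ p *
   rGamma (INR n * alpha + INR m * beta + INR p * gamma + mu))%C.

Definition ML3 (alpha beta gamma : R) (x y z mu : C) : C :=
  sum3 (ML3_term alpha beta gamma x y z mu).

Definition Omega_minus (eps eta : R) (s : C) : Prop :=
  Cmod s < eps \/ (s <> 0 /\ eta < Rabs (Carg s)).

(** [s^a] for [s = r e^(i theta)], [r > 0]; it depends on [theta] itself and
    not only on [s], which matters on the two lips of the contour [eta = PI]. *)
Definition polar_pow (r theta : R) (a : C) : C :=
  Cexp (a * (ln r + Ci * theta))%C.

(** Integrals along omega(eps; eta) of a function [f r theta] of the polar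
    coordinates of [s]: [ds = e^(i theta) dr] on the two rays (the lower one
    being traversed from infinity to [eps]) and [ds = i eps e^(i theta) dtheta]
    on the arc. *)
Definition ray_part (f : R -> R -> C) (theta : R) : R -> C :=
  fun r => (f r theta * Cexp (Ci * theta))%C.

Definition arc_part (f : R -> R -> C) (eps : R) : R -> C :=
  fun theta => (f eps theta * (Ci * eps * Cexp (Ci * theta)))%C.

Definition ex_omega_int (eps eta : R) (f : R -> R -> C) : Prop :=
  ex_RInt_gen (V := C_R_NormedModule) (ray_part f (- eta))
    (at_point eps) (Rbar_locally p_infty) /\
  ex_RInt (V := C_R_NormedModule) (arc_part f eps) (- eta) eta /\
  ex_RInt_gen (V := C_R_NormedModule) (ray_part f eta)
    (at_point eps) (Rbar_locally p_infty).

Definition omega_int (eps eta : R) (f : R -> R -> C) : C :=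
  (- RInt_gen (V := C_R_CompleteNormedModule) (ray_part f (- eta))
       (at_point eps) (Rbar_locally p_infty)
   + RInt (V := C_R_CompleteNormedModule) (arc_part f eps) (- eta) eta
   + RInt_gen (V := C_R_CompleteNormedModule) (ray_part f eta)
       (at_point eps) (Rbar_locally p_infty))%C.

Definition ML3_integrand (alpha beta gamma : R) (x y z mu : C) (r theta : R) : C :=
  (Cexp (polar_pow r theta (1 / (alpha * beta * gamma))) *
   polar_pow r theta
     ((alpha + beta + gamma + 1 - mu) / (alpha * beta * gamma) - 1) /
   ((polar_pow r theta (1 / (beta * gamma)) - x) *
    (polar_pow r theta (1 / (alpha * gamma)) - y) *
    (polar_pow r theta (1 / (alpha * beta)) - z)))%C.

(* Main.v *)
Require Import Defs.
From Stdlib Require Import Reals Factorial Lra Lia Psatz.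
From Coquelicot Require Import Coquelicot.

(** Put d = alpha beta gamma, and substitute s = u^d and then u = e^v in the contour
    integral. The contour becomes a Hankel contour in u with opening angle
    theta = eta/d, and the hypothesis on eta gives pi/2 < theta <= pi. On its rays
    the real part of u is therefore negative and the factor e^u makes everything
    converge. The integrand becomes

      e^u u^(- mu) / ((1 - x u^(- alpha)) (1 - y u^(- beta)) (1 - z u^(- gamma))) du,

    and in the coordinate v all powers of u are entire functions, so that no
    branch has to be chosen.

    The hypotheses on x, y and z say that none of the denominators vanishes on the
    contour or to the right of it ([Omega_minus_pole_free]). By Cauchy's theorem
    ([hankel_move]) the radius of the contour can therefore be increased without
    changing the integral, until the three ratios have modulus at most 1/2. This
    replaces an analytic continuation in x, y and z. On the large contour the
    three factors are expanded into geometric series, which converge uniformly,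
    and the terms are integrated one by one ([hankel_MLkernel]). Each of them is a
    Hankel integral of e^u u^(- w), which is 2 pi i / Gamma (w) by
    [hankel_rGamma]. The same formula, estimated on the large contour, gives the
    absolute summability of the series ([ML3_abs_summable]).

    Since 1/Gamma is defined here by Gauss's limit, Hankel's formula has to be
    connected with that limit. Integration by parts n+1 times writes the Hankel
    integral as z (z+1) ... (z+n) times the Hankel integral at z+n+1. On a contour
    of radius n, Laplace's method shows that the latter is asymptotic to
    2 pi i / (n! n^z); the exact value at z = 0, a residue, serves as
    normalisation ([hankel_kernel_gauss_limit]).

    Cauchy's theorem is needed on rectangles in the v-plane only. There it
    follows by differentiating under the integral sign ([arc_derive]). *)

Open Scope R_scope.

(** * The complex exponential *)

Lemma Cexp_plus (z w : C) : Cexp (z + w) = (Cexp z * Cexp w)%C.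
Proof.
  unfold Cexp, Cmult, Cplus, Re, Im; simpl.
  rewrite exp_plus, cos_plus, sin_plus; f_equal; ring.
Qed.

Lemma Cexp_0 : Cexp 0 = 1.
Proof. unfold Cexp; simpl; rewrite exp_0, cos_0, sin_0; apply injective_projections; simpl; ring. Qed.

Lemma Cmod_Cexp (z : C) : Cmod (Cexp z) = exp (Re z).
Proof.
  unfold Cmod, Cexp; simpl.
  transitivity (sqrt (exp (Re z) ^ 2)).
  - f_equal. pose proof (sin2_cos2 (Im z)) as H. unfold Rsqr in H.
    nra.
  - apply sqrt_pow2, Rlt_le, exp_pos.
Qed.

Lemma Cexp_neq_0 (z : C) : Cexp z <> 0.
Proof.
  intro H. pose proof (Cmod_Cexp z) as H1. rewrite H, Cmod_0 in H1.
  pose proof (exp_pos (Re z)); lra.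
Qed.

Lemma Cexp_opp (z : C) : Cexp (- z) = (/ Cexp z)%C.
Proof.
  assert (H : (Cexp z * Cexp (- z) = 1)%C).
  { rewrite <- Cexp_plus, Cplus_opp_r. apply Cexp_0. }
  transitivity (/ Cexp z * (Cexp z * Cexp (- z)))%C.
  - field. apply Cexp_neq_0.
  - rewrite H. ring.
Qed.

Lemma Cexp_RtoC (t : R) : Cexp t = exp t.
Proof. unfold Cexp; simpl. rewrite cos_0, sin_0. apply injective_projections; simpl; ring. Qed.

Lemma Cexp_INR (n : nat) (z : C) : Cexp (INR n * z) = (Cexp z ^ n)%C.
Proof.
  induction n as [|n IH].
  - simpl. rewrite Cmult_0_l. apply Cexp_0.
  - rewrite S_INR, RtoC_plus, Cpow_S, <- IH, <- Cexp_plus. f_equal. ring.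
Qed.


(** * Differentiable and continuous complex-valued functions *)

Definition cderive (c : R -> C) (x : R) (d : C) : Prop :=
  is_derive (fun t => Re (c t)) x (Re d) /\ is_derive (fun t => Im (c t)) x (Im d).

Lemma is_derive_eq (f : R -> R) (x l l' : R) : is_derive f x l -> l = l' -> is_derive f x l'.
Proof. now intros H <-. Qed.

Lemma cderive_eq c x d d' : cderive c x d -> d = d' -> cderive c x d'.
Proof. now intros H <-. Qed.

Lemma cderive_ext c1 c2 x d : (forall t, c1 t = c2 t) -> cderive c1 x d -> cderive c2 x d.
Proof.
  intros H [H1 H2]; split; [apply (is_derive_ext (fun t => Re (c1 t)))|apply (is_derive_ext (fun t => Im (c1 t)))];
    try assumption; intro t; now rewrite H.
Qed.

(** The derivative is taken componentwise because every rule then follows from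
    calculus in one real variable; the fundamental theorem of calculus needs it
    in the normed space C instead, and this is the bridge. *)
Lemma cderive_is_derive (c : R -> C) x d :
  cderive c x d -> is_derive (V := C_R_NormedModule) c x d.
Proof.
  intros [H1 H2].
  apply (is_derive_ext (fun t => (Re (c t), Im (c t)) : C_R_NormedModule)).
  { intro t; now destruct (c t). }
  assert (K := filterdiff_comp'_2 (K := R_AbsRing) (fun t => Re (c t)) (fun t => Im (c t))
    (fun a b => (a, b) : C_R_NormedModule) x _ _ (fun a b => (a, b)) H1 H2).
  unfold is_derive.
  eapply filterdiff_ext_lin.
  - apply K. apply (filterdiff_ext (fun t => t)); [now intros []|].
    apply filterdiff_ext_lin with (fun t => t); [apply filterdiff_id | now intros []].
  - intro y. simpl. destruct d; reflexivity.
Qed.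

Lemma cderive_const (k : C) x : cderive (fun _ => k) x 0.
Proof. split; simpl; apply @is_derive_const. Qed.

Lemma cderive_hor (y x : R) : cderive (fun t => (t, y)) x 1.
Proof. split; simpl; [apply @is_derive_id | apply @is_derive_const]. Qed.

Lemma cderive_ver (y x : R) : cderive (fun t => (y, t)) x Ci.
Proof. split; simpl; [apply @is_derive_const | apply @is_derive_id]. Qed.

Lemma cderive_plus f g x df dg :
  cderive f x df -> cderive g x dg -> cderive (fun t => f t + g t)%C x (df + dg)%C.
Proof.
  intros [F1 F2] [G1 G2]; split; simpl.
  - apply (is_derive_plus (fun t => Re (f t)) (fun t => Re (g t)) x _ _ F1 G1).
  - apply (is_derive_plus (fun t => Im (f t)) (fun t => Im (g t)) x _ _ F2 G2).
Qed.

Lemma cderive_mult f g x df dg :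
  cderive f x df -> cderive g x dg -> cderive (fun t => f t * g t)%C x (df * g x + f x * dg)%C.
Proof.
  assert (M : forall a b (da db : R), is_derive a x da -> is_derive b x db ->
    is_derive (fun t => a t * b t) x (da * b x + a x * db)).
  { intros a b da db A B. apply (is_derive_mult a b x da db A B). intros; apply Rmult_comm. }
  intros [F1 F2] [G1 G2]; split; unfold Re, Im, Cmult in *; simpl.
  - eapply is_derive_eq.
    + apply (is_derive_minus (fun t => fst (f t) * fst (g t)) (fun t => snd (f t) * snd (g t)));
        apply M; eassumption.
    + unfold minus, plus, opp; simpl; ring.
  - eapply is_derive_eq.
    + apply (is_derive_plus (fun t => fst (f t) * snd (g t)) (fun t => snd (f t) * fst (g t)));
        apply M; eassumption.
    + unfold minus, plus, opp; simpl; ring.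
Qed.

Lemma cderive_exp f x df :
  cderive f x df -> cderive (fun t => Cexp (f t)) x (df * Cexp (f x))%C.
Proof.
  assert (K : forall a b (da db : R), is_derive a x da -> is_derive b x db ->
    is_derive (fun t => exp (a t) * cos (b t)) x (da * (exp (a x) * cos (b x)) - db * (exp (a x) * sin (b x))) /\
    is_derive (fun t => exp (a t) * sin (b t)) x (da * (exp (a x) * sin (b x)) + db * (exp (a x) * cos (b x)))).
  { intros a b da db A B.
    split; (auto_derive; [repeat split; eexists; eassumption|]);
      (replace (Derive (fun x0 => a x0) x) with da by (symmetry; now apply is_derive_unique));
      (replace (Derive (fun x0 => b x0) x) with db by (symmetry; now apply is_derive_unique)); ring. }
  intros [F1 F2]. destruct (K _ _ _ _ F1 F2) as [A B].
  split; (eapply is_derive_eq; [eassumption|]); unfold Cexp, Re, Im; simpl; ring.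
Qed.

Lemma Csqr_neq_0 (z : C) : z <> 0 -> fst z ^ 2 + snd z ^ 2 <> 0.
Proof.
  intros H E. apply H. destruct z as [a b]; simpl in E.
  assert (a = 0) by nra. assert (b = 0) by nra. subst; reflexivity.
Qed.

Lemma cderive_inv f x df :
  cderive f x df -> f x <> 0 -> cderive (fun t => / f t)%C x (- df / (f x * f x))%C.
Proof.
  assert (K : forall a b (da db : R), is_derive a x da -> is_derive b x db -> a x ^ 2 + b x ^ 2 <> 0 ->
    is_derive (fun t => a t / (a t ^ 2 + b t ^ 2)) x
      ((da * (b x ^ 2 - a x ^ 2) - 2 * a x * b x * db) / (a x ^ 2 + b x ^ 2) ^ 2) /\
    is_derive (fun t => - b t / (a t ^ 2 + b t ^ 2)) x
      ((db * (b x ^ 2 - a x ^ 2) + 2 * a x * b x * da) / (a x ^ 2 + b x ^ 2) ^ 2)).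
  { intros a b da db A B N.
    split; (auto_derive; [repeat split; try (eexists; eassumption); simpl in N; exact N|]);
      (replace (Derive (fun x0 => a x0) x) with da by (symmetry; now apply is_derive_unique));
      (replace (Derive (fun x0 => b x0) x) with db by (symmetry; now apply is_derive_unique));
      simpl; field; intro Z; apply N; rewrite <- Z; ring. }
  intros [F1 F2] N.
  assert (N' := Csqr_neq_0 _ N).
  assert (N2 := Csqr_neq_0 _ (Cmult_neq_0 _ _ N N)).
  destruct (K _ _ _ _ F1 F2 N') as [A B].
  split; (eapply is_derive_eq; [eassumption|]); unfold Cdiv, Cinv, Cmult, Copp, Re, Im in *; simpl in *; field;
    (split; [intro Z; apply N2; rewrite <- Z; ring | intro Z; apply N'; rewrite <- Z; ring]).
Qed.


Lemma continuous_pairC {U : UniformSpace} (f : U -> C) (x : U) :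
  continuous (fun u => Re (f u)) x -> continuous (fun u => Im (f u)) x -> continuous f x.
Proof.
  intros H1 H2. apply (continuous_ext (fun u => (Re (f u), Im (f u)))).
  { intro t; now destruct (f t). }
  intros P [e HP].
  assert (K1 := H1 _ (locally_ball (Re (f x)) e)).
  assert (K2 := H2 _ (locally_ball (Im (f x)) e)).
  unfold filtermap in *.
  generalize (filter_and _ _ K1 K2). apply filter_imp.
  intros u [B1 B2]. apply HP. split; assumption.
Qed.

Lemma continuous_Re {U : UniformSpace} (f : U -> C) (x : U) : continuous f x -> continuous (fun u => Re (f u)) x.
Proof. intros H. apply (continuous_comp f (fun z : C => fst z)); [exact H|]. apply continuous_fst. Qed.

Lemma continuous_Im {U : UniformSpace} (f : U -> C) (x : U) : continuous f x -> continuous (fun u => Im (f u)) x.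
Proof. intros H. apply (continuous_comp f (fun z : C => snd z)); [exact H|]. apply continuous_snd. Qed.

Lemma continuous_Cplus {U : UniformSpace} (f g : U -> C) (x : U) :
  continuous f x -> continuous g x -> continuous (fun u => f u + g u)%C x.
Proof.
  intros F G. apply continuous_pairC; simpl.
  - apply @continuous_plus with (V := R_NormedModule); now apply continuous_Re.
  - apply @continuous_plus with (V := R_NormedModule); now apply continuous_Im.
Qed.

Lemma continuous_Cmult {U : UniformSpace} (f g : U -> C) (x : U) :
  continuous f x -> continuous g x -> continuous (fun u => f u * g u)%C x.
Proof.
  intros F G. pose proof (continuous_Re _ _ F). pose proof (continuous_Im _ _ F).
  pose proof (continuous_Re _ _ G). pose proof (continuous_Im _ _ G).
  apply continuous_pairC; simpl.
  - apply @continuous_minus with (V := R_NormedModule); now apply @continuous_mult with (K := R_AbsRing).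
  - apply @continuous_plus with (V := R_NormedModule); now apply @continuous_mult with (K := R_AbsRing).
Qed.

Lemma continuous_Cexp {U : UniformSpace} (f : U -> C) (x : U) : continuous f x -> continuous (fun u => Cexp (f u)) x.
Proof.
  intros F. pose proof (continuous_Re _ _ F). pose proof (continuous_Im _ _ F).
  apply continuous_pairC; simpl; apply @continuous_mult with (K := R_AbsRing);
   (apply continuous_comp; [assumption|]).
  - apply continuous_exp.
  - apply continuous_cos.
  - apply continuous_exp.
  - apply continuous_sin.
Qed.

Lemma continuous_Cinv {U : UniformSpace} (f : U -> C) (x : U) : continuous f x -> f x <> 0 -> continuous (fun u => / f u)%C x.
Proof.
  intros F N. pose proof (continuous_Re _ _ F) as A. pose proof (continuous_Im _ _ F) as B.
  unfold Re, Im in A, B.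
  apply Csqr_neq_0 in N.
  assert (D : continuous (fun u => / (fst (f u) ^ 2 + snd (f u) ^ 2)) x).
  { apply (continuous_comp (fun u => fst (f u) ^ 2 + snd (f u) ^ 2) Rinv).
    - apply @continuous_plus with (V := R_NormedModule);
      (simpl; apply @continuous_mult with (K := R_AbsRing);
       [assumption|apply @continuous_mult with (K := R_AbsRing); [assumption|apply continuous_const]]).
    - now apply continuous_Rinv. }
  apply continuous_pairC; unfold Cinv; simpl; apply @continuous_mult with (K := R_AbsRing).
  - exact A.
  - exact D.
  - apply (@continuous_opp _ _ R_NormedModule). exact B.
  - exact D.
Qed.

Lemma continuous_Cminus {U : UniformSpace} (f g : U -> C) x :
  continuous f x -> continuous g x -> continuous (fun u => f u - g u)%C x.
Proof.
  intros F G. apply continuous_Cplus; [exact F|].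
  assert (E : forall u, (- (1) * g u = - g u)%C) by (intro; ring).
  apply (continuous_ext (fun u => (- (1)) * g u)%C); [exact E|].
  apply continuous_Cmult; [apply continuous_const|exact G].
Qed.

(** * Holomorphic functions *)

(** Complex differentiability is encoded by the chain rule along every
    differentiable real curve through [v]: composition rules are then immediate,
    and the horizontal and vertical lines give the Cauchy-Riemann relation. *)
Definition curve_deriv (G : C -> C) (v d : C) : Prop :=
  forall c x c', c x = v -> cderive c x c' -> cderive (fun t => G (c t)) x (c' * d)%C.

(** Continuity of [G] and of its derivative is part of the notion, since
    differentiability along curves does not obviously provide it and
    differentiation under the integral sign uses it. *)
Definition holo_with (G G' : C -> C) (v : C) : Prop :=
  locally v (fun w => curve_deriv G w (G' w)) /\ continuous G v /\ continuous G' v.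

Definition holo (G : C -> C) (v : C) : Prop := exists G', holo_with G G' v.

Lemma holo_continuous G v : holo G v -> continuous G v.
Proof. intros (G' & _ & H & _). exact H. Qed.

Lemma holo_ext F G v : (forall w, F w = G w) -> holo F v -> holo G v.
Proof.
  intros E (G' & H1 & H2 & H3). exists G'; split; [|split; [|assumption]].
  - revert H1; apply filter_imp; intros w H c s c' Hc D.
    apply (cderive_ext (fun t => F (c t))); [intro; apply E|now apply H].
  - apply (continuous_ext F); [exact E|assumption].
Qed.

Lemma holo_const k v : holo (fun _ => k) v.
Proof.
  exists (fun _ => 0%C); split; [|split; apply continuous_const].
  apply filter_forall; intros w c x c' _ _.
  eapply cderive_eq; [apply cderive_const|ring].
Qed.

Lemma holo_id v : holo (fun w => w) v.
Proof.
  exists (fun _ => 1%C); split; [|split; [apply continuous_id|apply continuous_const]].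
  apply filter_forall; intros w c x c' _ H.
  eapply cderive_eq; [apply H|ring].
Qed.

Lemma holo_plus F G v : holo F v -> holo G v -> holo (fun w => F w + G w)%C v.
Proof.
  intros (F' & F1 & F2 & F3) (G' & G1 & G2 & G3).
  exists (fun w => F' w + G' w)%C; split; [|split; now apply continuous_Cplus].
  generalize (filter_and _ _ F1 G1); apply filter_imp; intros w [A B] c x c' E D.
  eapply cderive_eq; [apply cderive_plus; [apply A|apply B]; eassumption|ring].
Qed.

Lemma holo_mult F G v : holo F v -> holo G v -> holo (fun w => F w * G w)%C v.
Proof.
  intros (F' & F1 & F2 & F3) (G' & G1 & G2 & G3).
  exists (fun w => F' w * G w + F w * G' w)%C; split; [|split].
  - generalize (filter_and _ _ F1 G1); apply filter_imp; intros w [A B] c x c' E D.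
    eapply cderive_eq; [apply cderive_mult; [apply A|apply B]; eassumption|]. cbv beta; rewrite E; ring.
  - now apply continuous_Cmult.
  - apply continuous_Cplus; now apply continuous_Cmult.
Qed.

Lemma holo_Cexp F v : holo F v -> holo (fun w => Cexp (F w)) v.
Proof.
  intros (F' & F1 & F2 & F3).
  exists (fun w => F' w * Cexp (F w))%C; split; [|split].
  - revert F1; apply filter_imp; intros w A c x c' E D.
    eapply cderive_eq; [apply cderive_exp; eapply A; eassumption|]. cbv beta; rewrite E; ring.
  - now apply continuous_Cexp.
  - apply continuous_Cmult; [assumption|now apply continuous_Cexp].
Qed.

Lemma continuous_neq_0 {U : UniformSpace} (f : U -> C) x :
  continuous f x -> f x <> 0 -> locally x (fun u => f u <> 0).
Proof.
  intros F N.
  assert (N' := Csqr_neq_0 _ N).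
  assert (F' : continuous (fun u => fst (f u) ^ 2 + snd (f u) ^ 2) x).
  { pose proof (continuous_Re _ _ F) as A. pose proof (continuous_Im _ _ F) as B.
    apply @continuous_plus with (V := R_NormedModule);
      (simpl; apply @continuous_mult with (K := R_AbsRing);
       [assumption|apply @continuous_mult with (K := R_AbsRing); [assumption|apply continuous_const]]). }
  assert (P : 0 < fst (f x) ^ 2 + snd (f x) ^ 2) by nra.
  assert (K := F' _ (locally_ball _ (mkposreal _ P))). unfold filtermap in K.
  revert K; apply filter_imp. intros u B E. rewrite E in B.
  unfold ball in B; simpl in B. unfold AbsRing_ball, abs, minus, plus, opp in B; simpl in B.
  rewrite Rabs_left in B; nra.
Qed.

Lemma holo_Cinv F v : holo F v -> F v <> 0 -> holo (fun w => / F w)%C v.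
Proof.
  intros (F' & F1 & F2 & F3) N.
  assert (N2 := continuous_neq_0 F v F2 N).
  exists (fun w => - F' w / (F w * F w))%C; split; [|split].
  - generalize (filter_and _ _ F1 N2); apply filter_imp; intros w [A B] c x c' E D.
    eapply cderive_eq; [apply cderive_inv; [eapply A; eassumption|cbv beta; now rewrite E]|]. cbv beta; rewrite E.
    field; exact B.
  - now apply continuous_Cinv.
  - apply continuous_Cmult.
    + assert (E : forall w, (- (1) * F' w = - F' w)%C) by (intro; ring).
      apply (continuous_ext (fun w => (- (1)) * F' w)%C); [exact E|].
      apply continuous_Cmult; [apply continuous_const|assumption].
    + apply continuous_Cinv; [now apply continuous_Cmult|now apply Cmult_neq_0].
Qed.

Definition hderiv (G : C -> C) (v : C) : C :=
  (Derive (fun t => Re (G (t, Im v))) (Re v), Derive (fun t => Im (G (t, Im v))) (Re v)).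

Lemma hderiv_unique G v d : curve_deriv G v d -> hderiv G v = d.
Proof.
  intro H.
  destruct (H (fun t => (t, Im v)) (Re v) 1%C) as [A B].
  - now destruct v.
  - apply cderive_hor.
  - rewrite Cmult_1_l in A, B.
    apply is_derive_unique in A; apply is_derive_unique in B.
    apply injective_projections; [exact A|exact B].
Qed.

(** The derivative in [holo] is only given locally and existentially; as a
    derivative along horizontal lines it is determined, so one global function
    serves at all points. *)
Lemma holo_hderiv G v : holo G v -> holo_with G (hderiv G) v.
Proof.
  intros (G' & A & B & D).
  assert (E : locally v (fun w => G' w = hderiv G w)).
  { revert A; apply filter_imp; intros w H. symmetry; now apply hderiv_unique. }
  split; [|split].
  - generalize (filter_and _ _ A E); apply filter_imp; intros w [H1 H2]. now rewrite <- H2.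
  - exact B.
  - eapply continuous_ext_loc; [|exact D]. exact E.
Qed.

(** * Integrals over segments and Cauchy's theorem on rectangles *)

Notation is_RIntC := (is_RInt (V := C_R_NormedModule)).

Lemma norm_Cmod (z : C) : norm (z : C_R_NormedModule) = Cmod z.
Proof.
  unfold norm; simpl. unfold prod_norm, Cmod, norm; simpl. unfold abs; simpl.
  f_equal. f_equal; rewrite Rmult_1_r; rewrite Rmult_1_r; rewrite <- Rabs_mult; apply Rabs_pos_eq; apply Rle_0_sqr.
Qed.

Lemma is_RIntC_derive (f df : R -> C) a b :
  a <= b ->
  (forall t, a <= t <= b -> cderive f t (df t)) ->
  (forall t, a <= t <= b -> continuous df t) ->
  is_RIntC df a b (f b - f a)%C.
Proof.
  intros ab D Cd.
  apply (is_RInt_derive (V := C_R_CompleteNormedModule) f df a b);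
    rewrite Rmin_left, Rmax_right by assumption.
  - intros t Ht. apply cderive_is_derive. now apply D.
  - exact Cd.
Qed.

Lemma cderive_Ci c x d : cderive c x d -> cderive (fun t => Ci * c t)%C x (Ci * d)%C.
Proof.
  intro H. eapply cderive_eq.
  - apply cderive_mult; [apply cderive_const|exact H].
  - cbv beta; ring.
Qed.

Lemma is_RIntC_Cmult (k : C) (f : R -> C) a b l :
  is_RIntC f a b l -> is_RIntC (fun t => k * f t)%C a b (k * l)%C.
Proof.
  intro H.
  assert (A := is_RInt_fct_extend_fst (U := R_NormedModule) (V := R_NormedModule) _ _ _ _ H).
  assert (B := is_RInt_fct_extend_snd (U := R_NormedModule) (V := R_NormedModule) _ _ _ _ H).
  apply (is_RInt_fct_extend_pair (U := R_NormedModule) (V := R_NormedModule)).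
  - apply (is_RInt_minus (V := R_NormedModule) (fun t => fst k * fst (f t)) (fun t => snd k * snd (f t)));
    now apply (is_RInt_scal (V := R_NormedModule)).
  - apply (is_RInt_plus (V := R_NormedModule) (fun t => fst k * snd (f t)) (fun t => snd k * fst (f t)));
    now apply (is_RInt_scal (V := R_NormedModule)).
Qed.

Lemma is_RIntC_unique (f : R -> C) a b l l' : is_RIntC f a b l -> is_RIntC f a b l' -> l = l'.
Proof.
  intros H H'. transitivity (RInt (V := C_R_CompleteNormedModule) f a b); [symmetry|];
   now apply (is_RInt_unique (V := C_R_CompleteNormedModule)).
Qed.

Lemma is_RIntC_comp (f : R -> C) (g dg : R -> R) a b l :
  a <= b ->
  (forall t, a <= t <= b -> continuous f (g t)) ->
  (forall t, a <= t <= b -> is_derive g t (dg t) /\ continuous dg t) ->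
  is_RIntC f (g a) (g b) l ->
  is_RIntC (fun t => dg t * f (g t))%C a b l.
Proof.
  intros ab H1 H2 H.
  apply (is_RInt_unique (V := C_R_CompleteNormedModule)) in H. rewrite <- H.
  apply (is_RInt_ext (V := C_R_NormedModule) (fun t => scal (dg t) (f (g t)))).
  - intros t _. apply injective_projections; simpl; unfold scal; simpl; unfold mult; simpl; ring.
  - apply (is_RInt_comp (V := C_R_CompleteNormedModule)); rewrite Rmin_left, Rmax_right by assumption; assumption.
Qed.


Lemma continuous_hor (G : C -> C) t y : continuous G (t, y) -> continuous (fun u : R => G (u, y)) t.
Proof.
  intro H. apply (continuous_comp (fun u : R => (u, y) : C) G); [|exact H].
  apply continuous_pairC; simpl; [apply continuous_id|apply continuous_const].
Qed.

Lemma continuous_ver (G : C -> C) t y : continuous G (t, y) -> continuous (fun u : R => G (t, u)) y.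
Proof.
  intro H. apply (continuous_comp (fun u : R => (t, u) : C) G); [|exact H].
  apply continuous_pairC; simpl; [apply continuous_const|apply continuous_id].
Qed.

Lemma holo_ver_cderive G t y : holo G (t, y) -> cderive (fun u : R => G (t, u)) y (Ci * hderiv G (t, y))%C.
Proof.
  intro H. apply holo_hderiv in H. destruct H as [H _].
  apply locally_singleton in H. apply H; [reflexivity|apply cderive_ver].
Qed.

Lemma holo_hor_cderive G t y : holo G (t, y) -> cderive (fun u : R => G (u, y)) t (hderiv G (t, y))%C.
Proof.
  intro H. apply holo_hderiv in H. destruct H as [H _].
  apply locally_singleton in H. eapply cderive_eq; [apply H; [reflexivity|apply cderive_hor]|ring].
Qed.

Definition RIntC (f : R -> C) (a b : R) : C := RInt (V := C_R_CompleteNormedModule) f a b.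

Lemma RIntC_correct (f : R -> C) a b :
  a <= b -> (forall t, a <= t <= b -> continuous f t) -> is_RIntC f a b (RIntC f a b).
Proof.
  intros ab H.
  apply (RInt_correct (V := C_R_CompleteNormedModule)).
  apply (ex_RInt_continuous (V := C_R_CompleteNormedModule)).
  now rewrite Rmin_left, Rmax_right by assumption.
Qed.

Definition arc (G : C -> C) (a b t : R) : C := RIntC (fun y => G (t, y)) a b.

Lemma arc_correct G a b t : a <= b -> (forall y, a <= y <= b -> continuous G (t, y)) ->
  is_RIntC (fun y => G (t, y)) a b (arc G a b t).
Proof.
  intros ab H. apply RIntC_correct; [assumption|].
  intros y Hy. apply continuous_ver. now apply H.
Qed.

Lemma arc_components G a b t : a <= b -> (forall y, a <= y <= b -> continuous G (t, y)) ->
  arc G a b t = (RInt (fun y => Re (G (t, y))) a b, RInt (fun y => Im (G (t, y))) a b).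
Proof.
  intros ab H. pose proof (arc_correct G a b t ab H) as K.
  apply injective_projections; simpl; symmetry; apply is_RInt_unique.
  - apply (is_RInt_fct_extend_fst (U := R_NormedModule) (V := R_NormedModule) _ _ _ _ K).
  - apply (is_RInt_fct_extend_snd (U := R_NormedModule) (V := R_NormedModule) _ _ _ _ K).
Qed.

Lemma is_derive_RInt_hor (g dg : R -> R -> R) a b lo t :
  a <= b -> lo < t ->
  (forall s y, lo < s -> a <= y <= b -> is_derive (fun u => g u y) s (dg s y)) ->
  (forall s y, lo < s -> a <= y <= b -> continuous (fun u => g s u) y) ->
  (forall y, a <= y <= b -> continuous (fun z : R * R => Derive (fun u => g u (snd z)) (fst z)) (t, y)) ->
  is_derive (fun s => RInt (fun y => g s y) a b) t (RInt (fun y => dg t y) a b).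
Proof.
  intros ab lot D Cg Cd.
  assert (L : locally t (fun s => lo < s)).
  { apply (open_gt lo t lot). }
  eapply is_derive_eq.
  - apply (is_derive_RInt_param g a b t).
    + revert L; apply filter_imp; intros s Hs y. rewrite Rmin_left, Rmax_right by assumption.
      intros Hy. eexists. now apply D.
    + intros y. rewrite Rmin_left, Rmax_right by assumption. intros Hy.
      apply continuity_2d_pt_filterlim. exact (Cd y Hy).
    + revert L; apply filter_imp; intros s Hs.
      apply (ex_RInt_continuous (V := R_CompleteNormedModule)).
      rewrite Rmin_left, Rmax_right by assumption. intros y Hy. now apply Cg.
  - apply RInt_ext. rewrite Rmin_left, Rmax_right by assumption. intros y Hy.
    apply is_derive_unique. apply D; lra.
Qed.

(** Cauchy's theorem in infinitesimal form: the derivative of the integral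
    over a vertical segment is the integral of [G'], and [i G'] is the derivative
    of [G] along the segment, so only the end points remain. Holomorphy is
    required on the whole half-strip right of [lo < t], which gives a
    neighbourhood of the closed segment that is uniform in [y]. *)
Lemma arc_derive G a b lo t :
  a <= b -> lo < t ->
  (forall s y, lo < s -> a <= y <= b -> holo G (s, y)) ->
  cderive (fun s => Ci * arc G a b s)%C t (G (t, b) - G (t, a))%C.
Proof.
  intros ab lot H.
  assert (HC : forall s y, lo < s -> a <= y <= b -> continuous G (s, y)).
  { intros; apply holo_continuous; now apply H. }
  assert (Cd : forall y, a <= y <= b -> continuous (hderiv G) (t, y)).
  { intros y Hy. now apply holo_hderiv, H. }
  assert (E : is_RIntC (fun y => Ci * hderiv G (t, y))%C a b (G (t, b) - G (t, a))%C).
  { apply (is_RIntC_derive (fun y => G (t, y))); [assumption| |].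
    - intros y Hy. apply holo_ver_cderive. now apply H.
    - intros y Hy. apply (continuous_ver (fun z => Ci * hderiv G z)%C).
      apply continuous_Cmult; [apply continuous_const|now apply Cd]. }
  assert (E2 : is_RIntC (fun y => hderiv G (t, y))%C a b (RInt (fun y => Re (hderiv G (t,y))) a b, RInt (fun y => Im (hderiv G (t, y))) a b)).
  { apply (is_RInt_fct_extend_pair (U := R_NormedModule) (V := R_NormedModule));
     apply (RInt_correct (V := R_CompleteNormedModule)), (ex_RInt_continuous (V := R_CompleteNormedModule));
     rewrite Rmin_left, Rmax_right by assumption; intros y Hy.
     - apply continuous_Re with (f := fun y : R => hderiv G (t, y)); apply continuous_ver; now apply Cd.
     - apply continuous_Im with (f := fun y : R => hderiv G (t, y)); apply continuous_ver; now apply Cd. }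
  rewrite (is_RIntC_unique _ _ _ _ _ E (is_RIntC_Cmult Ci _ _ _ _ E2)).
  apply cderive_Ci.
  assert (L : locally t (fun s => lo < s)) by (apply (open_gt lo t lot)).
  assert (A : locally t (fun s => (RInt (fun y => Re (G (s, y))) a b, RInt (fun y => Im (G (s, y))) a b) = arc G a b s)).
  { revert L; apply filter_imp; intros s Hs. symmetry; apply arc_components; [assumption|]. intros; now apply HC. }
  split.
  - apply (is_derive_ext_loc (fun s => RInt (fun y => Re (G (s, y))) a b)).
    { revert A; apply filter_imp; intros s Hs. now rewrite <- Hs. }
    simpl. apply (is_derive_RInt_hor (fun s y => Re (G (s, y))) (fun s y => Re (hderiv G (s, y))) a b lo t ab lot).
    + intros s y Hs Hy. apply (holo_hor_cderive G s y). now apply H.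
    + intros s y Hs Hy. apply continuous_Re, continuous_ver. now apply HC.
    + intros y Hy. apply (continuous_ext (fun z => Re (hderiv G z))).
      { intros [u v]; reflexivity. }
      apply continuous_Re. now apply Cd.
  - apply (is_derive_ext_loc (fun s => RInt (fun y => Im (G (s, y))) a b)).
    { revert A; apply filter_imp; intros s Hs. now rewrite <- Hs. }
    simpl. apply (is_derive_RInt_hor (fun s y => Im (G (s, y))) (fun s y => Im (hderiv G (s, y))) a b lo t ab lot).
    + intros s y Hs Hy. apply (holo_hor_cderive G s y). now apply H.
    + intros s y Hs Hy. apply continuous_Im, continuous_ver. now apply HC.
    + intros y Hy. apply (continuous_ext (fun z => Im (hderiv G z))).
      { intros [u v]; reflexivity. }
      apply continuous_Im. now apply Cd.
Qed.

(** Cauchy's theorem on the rectangle with sides [t0, t1] and [a, b], by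
    integrating [arc_derive]. *)
Lemma Cauchy_rectangle G a b lo t0 t1 :
  a <= b -> lo < t0 <= t1 ->
  (forall s y, lo < s -> a <= y <= b -> holo G (s, y)) ->
  is_RIntC (fun t => G (t, b) - G (t, a))%C t0 t1 (Ci * arc G a b t1 - Ci * arc G a b t0)%C.
Proof.
  intros ab lot H.
  apply (is_RIntC_derive (fun s => Ci * arc G a b s)%C); [lra| |].
  - intros t Ht. apply arc_derive with lo; [assumption|lra|assumption].
  - intros t Ht. apply continuous_Cminus; apply continuous_hor; apply holo_continuous; apply H; lra.
Qed.

(** * Integrals over half-lines *)

Definition tends_to (J : R -> C) (l : C) : Prop :=
  forall e, 0 < e -> exists T0, forall T, T0 <= T -> Cmod (J T - l) < e.

(** Improper integral, as a limit of proper ones; the multiplication by a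
    complex scalar and the estimates below are direct in this form. *)
Definition is_ray (f : R -> C) (a : R) (l : C) : Prop :=
  exists J, (forall T, a <= T -> is_RIntC f a T (J T)) /\ tends_to J l.

Lemma ball_Cmod (x y : C) (e : R) : Cmod (y - x) < e -> ball (M := C_UniformSpace) x e y.
Proof.
  intro H. split; unfold ball; simpl; unfold AbsRing_ball, abs, minus, plus, opp; simpl;
  eapply Rle_lt_trans; try exact H; destruct x as [a b], y as [c d]; simpl.
  - apply (Rle_trans _ (Rmax (Rabs (c + - a)) (Rabs (d + - b)))); [apply Rmax_l|].
    apply (Rmax_Cmod ((c,d) - (a,b))%C).
  - apply (Rle_trans _ (Rmax (Rabs (c + - a)) (Rabs (d + - b)))); [apply Rmax_r|].
    apply (Rmax_Cmod ((c,d) - (a,b))%C).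
Qed.

Lemma Cmod_Ci : Cmod Ci = 1.
Proof. unfold Cmod, Ci; simpl. replace (0 * (0 * 1) + 1 * (1 * 1)) with 1 by ring. apply sqrt_1. Qed.

Lemma Cmod_ball (x y : C) (e : R) : ball (M := C_UniformSpace) x e y -> Cmod (y - x) < 2 * e.
Proof.
  intros [A B]. unfold ball in A, B; simpl in A, B.
  unfold AbsRing_ball, abs, minus, plus, opp in A, B; simpl in A, B.
  destruct x as [a b], y as [c d]; simpl in *.
  apply Rle_lt_trans with (Rabs (c + - a) + Rabs (d + - b)); [|lra].
  replace ((c, d) - (a, b))%C with (RtoC (c + - a) + RtoC (d + - b) * Ci)%C.
  - eapply Rle_trans; [apply Cmod_triangle|]. rewrite Cmod_mult, !Cmod_R.
    rewrite Cmod_Ci. lra.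
  - apply injective_projections; simpl; ring.
Qed.

Lemma Cmod_eq_0_lim (z : C) : (forall e, 0 < e -> Cmod z < e) -> z = 0.
Proof.
  intro H. apply Cmod_eq_0. destruct (Rle_lt_or_eq_dec 0 (Cmod z) (Cmod_ge_0 z)) as [P|P]; [|now symmetry].
  specialize (H _ P). lra.
Qed.

Lemma Ceq_lim (z w : C) : (forall e, 0 < e -> Cmod (z - w) < e) -> z = w.
Proof.
  intro H. apply Cmod_eq_0_lim in H. transitivity (z - w + w)%C; [ring|]. rewrite H; ring.
Qed.

Lemma tends_to_unique J l l' : tends_to J l -> tends_to J l' -> l = l'.
Proof.
  intros H H'. apply Ceq_lim. intros e He.
  destruct (H (e / 2)) as [T1 H1]; [lra|]. destruct (H' (e / 2)) as [T2 H2]; [lra|].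
  specialize (H1 (Rmax T1 T2) (Rmax_l _ _)). specialize (H2 (Rmax T1 T2) (Rmax_r _ _)).
  replace (l - l')%C with (- (J (Rmax T1 T2) - l) + (J (Rmax T1 T2) - l'))%C by ring.
  eapply Rle_lt_trans; [apply Cmod_triangle|]. rewrite Cmod_opp. lra.
Qed.

Lemma tends_to_ext a J K l : (forall T, a <= T -> J T = K T) -> tends_to J l -> tends_to K l.
Proof.
  intros E H e He. destruct (H e He) as [T0 HT]. exists (Rmax a T0). intros T HT'.
  rewrite <- E. 
  - apply HT. eapply Rle_trans; [apply Rmax_r|exact HT'].
  - eapply Rle_trans; [apply Rmax_l|exact HT'].
Qed.

Lemma tends_to_plus J K l m : tends_to J l -> tends_to K m -> tends_to (fun T => J T + K T)%C (l + m)%C.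
Proof.
  intros H H' e He.
  destruct (H (e / 2)) as [T1 H1]; [lra|]. destruct (H' (e / 2)) as [T2 H2]; [lra|].
  exists (Rmax T1 T2). intros T HT.
  specialize (H1 T (Rle_trans _ _ _ (Rmax_l _ _) HT)). specialize (H2 T (Rle_trans _ _ _ (Rmax_r _ _) HT)).
  replace (J T + K T - (l + m))%C with ((J T - l) + (K T - m))%C by ring.
  eapply Rle_lt_trans; [apply Cmod_triangle|]. lra.
Qed.

Lemma tends_to_const l : tends_to (fun _ => l) l.
Proof. intros e He. exists 0. intros T _. replace (l - l)%C with (RtoC 0) by ring. now rewrite Cmod_0. Qed.

Lemma tends_to_Cmult k J l : tends_to J l -> tends_to (fun T => k * J T)%C (k * l)%C.
Proof.
  intros H e He. pose proof (Cmod_ge_0 k) as K.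
  destruct (H (e / (Cmod k + 1))) as [T1 H1].
  { apply Rdiv_lt_0_compat; lra. }
  exists T1. intros T HT. specialize (H1 T HT).
  replace (k * J T - k * l)%C with (k * (J T - l))%C by ring. rewrite Cmod_mult.
  apply Rle_lt_trans with (Cmod k * (e / (Cmod k + 1))).
  - apply Rmult_le_compat_l; lra.
  - apply Rlt_le_trans with ((Cmod k + 1) * (e / (Cmod k + 1))).
    + apply Rmult_lt_compat_r; [apply Rdiv_lt_0_compat; lra|lra].
    + right; field; lra.
Qed.

Lemma tends_to_exp_bound (J : R -> C) M a :
  (forall T, a <= T -> Cmod (J T) <= M * exp (- T)) -> tends_to J 0.
Proof.
  intros H e He.
  assert (P : 0 < e / (Rabs M + 1)). { pose proof (Rabs_pos M). apply Rdiv_lt_0_compat; lra. }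
  exists (Rmax a (1 - ln (e / (Rabs M + 1)))). intros T HT.
  assert (HT1 := Rle_trans _ _ _ (Rmax_l _ _) HT). assert (HT2 := Rle_trans _ _ _ (Rmax_r _ _) HT).
  replace (J T - 0)%C with (J T) by ring.
  eapply Rle_lt_trans; [apply H; assumption|].
  assert (X : exp (- T) < e / (Rabs M + 1)).
  { rewrite <- (exp_ln _ P) at 1. apply exp_increasing. lra. }
  pose proof (Rle_abs M). pose proof (Rabs_pos M). pose proof (exp_pos (- T)).
  apply Rle_lt_trans with (Rabs M * exp (- T)); [apply Rmult_le_compat_r; lra|].
  apply Rle_lt_trans with (Rabs M * (e / (Rabs M + 1))); [apply Rmult_le_compat_l; lra|].
  apply Rlt_le_trans with ((Rabs M + 1) * (e / (Rabs M + 1))); [apply Rmult_lt_compat_r; lra|].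
  right; field; lra.
Qed.

Lemma is_RIntC_Chasles (f : R -> C) a b c k l :
  is_RIntC f a b k -> is_RIntC f b c l -> is_RIntC f a c (k + l)%C.
Proof. apply (is_RInt_Chasles (V := C_R_NormedModule)). Qed.

Lemma is_RIntC_plus (f g : R -> C) a b k l :
  is_RIntC f a b k -> is_RIntC g a b l -> is_RIntC (fun t => f t + g t)%C a b (k + l)%C.
Proof. apply (is_RInt_plus (V := C_R_NormedModule)). Qed.

Lemma is_RIntC_ext (f g : R -> C) a b l :
  a <= b -> (forall t, a <= t <= b -> f t = g t) -> is_RIntC f a b l -> is_RIntC g a b l.
Proof.
  intros ab E. apply (is_RInt_ext (V := C_R_NormedModule)).
  rewrite Rmin_left, Rmax_right by assumption. intros t Ht. apply E; lra.
Qed.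

Lemma Cmod_RInt_le (f : R -> C) (g : R -> R) a b lf lg :
  a <= b -> (forall t, a <= t <= b -> Cmod (f t) <= g t) ->
  is_RIntC f a b lf -> is_RInt g a b lg -> Cmod lf <= lg.
Proof.
  intros ab H F G. rewrite <- norm_Cmod.
  apply (norm_RInt_le (V := C_R_NormedModule) f g a b); try assumption.
  intros t Ht. rewrite norm_Cmod. now apply H.
Qed.

Lemma is_RInt_exp_opp M a b : is_RInt (fun t => M * exp (- t)) a b (M * (exp (- a) - exp (- b))).
Proof.
  replace (M * (exp (- a) - exp (- b))) with (minus (- M * exp (- b)) (- M * exp (- a)))
    by (unfold minus, plus, opp; simpl; ring).
  apply (is_RInt_derive (V := R_CompleteNormedModule) (fun t => - M * exp (- t))).
  - intros t _. auto_derive; [trivial|ring].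
  - intros t _. apply (ex_derive_continuous (V := R_NormedModule)). auto_derive; trivial.
Qed.

Lemma is_ray_unique f a l l' : is_ray f a l -> is_ray f a l' -> l = l'.
Proof.
  intros (J & H1 & H2) (J' & H1' & H2').
  apply (tends_to_unique J); [assumption|].
  apply (tends_to_ext a J'); [|assumption].
  intros T HT. eapply is_RIntC_unique; [now apply H1'|now apply H1].
Qed.

Lemma is_ray_ext f g a l : (forall t, a <= t -> f t = g t) -> is_ray f a l -> is_ray g a l.
Proof.
  intros E (J & H1 & H2). exists J; split; [|assumption].
  intros T HT. apply (is_RIntC_ext f); [assumption| |now apply H1]. intros t Ht; now apply E.
Qed.

Lemma is_ray_plus f g a k l : is_ray f a k -> is_ray g a l -> is_ray (fun t => f t + g t)%C a (k + l)%C.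
Proof.
  intros (J & H1 & H2) (J' & H1' & H2'). exists (fun T => J T + J' T)%C; split; [|now apply tends_to_plus].
  intros T HT. apply is_RIntC_plus; auto.
Qed.

Lemma is_ray_Cmult k f a l : is_ray f a l -> is_ray (fun t => k * f t)%C a (k * l)%C.
Proof.
  intros (J & H1 & H2). exists (fun T => k * J T)%C; split; [|now apply tends_to_Cmult].
  intros T HT. apply is_RIntC_Cmult; auto.
Qed.

Lemma is_ray_back f a b k l : a <= b -> (forall t, a <= t -> continuous f t) ->
  is_RIntC f a b k -> is_ray f b l -> is_ray f a (k + l)%C.
Proof.
  intros ab Cf H (J & H1 & H2).
  exists (fun T => RIntC f a T). split.
  - intros T HT. apply RIntC_correct; [assumption|]. intros y Hy. apply Cf; apply Hy.
  - apply (tends_to_ext b (fun T => k + J T)%C).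
    + intros T HT. eapply is_RIntC_unique.
      * apply (is_RIntC_Chasles f a b T); [exact H|now apply H1].
      * apply RIntC_correct; [lra|]. intros y Hy. apply Cf; apply Hy.
    + apply tends_to_plus; [apply tends_to_const|assumption].
Qed.

Lemma is_ray_bound f a l M :
  (forall t, a <= t -> Cmod (f t) <= M * exp (- t)) -> is_ray f a l -> Cmod l <= M * exp (- a).
Proof.
  intros B (J & H1 & H2).
  assert (M0 : 0 <= M).
  { pose proof (B a (Rle_refl a)). pose proof (Cmod_ge_0 (f a)). pose proof (exp_pos (- a)). nra. }
  apply Rnot_lt_le; intro N.
  destruct (H2 (Cmod l - M * exp (- a))) as [T0 HT0]; [lra|].
  set (T := Rmax a T0). assert (aT : a <= T) by apply Rmax_l.
  specialize (HT0 T (Rmax_r _ _)).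
  assert (K : Cmod (J T) <= M * (exp (- a) - exp (- T))).
  { apply (Cmod_RInt_le f (fun t => M * exp (- t)) a T); auto.
    - intros t [Ht _]; auto.
    - apply is_RInt_exp_opp. }
  pose proof (exp_pos (- T)).
  assert (Cmod l <= Cmod (J T) + Cmod (J T - l)).
  { replace l with (J T + - (J T - l))%C at 1 by ring.
    eapply Rle_trans; [apply Cmod_triangle|]. rewrite Cmod_opp. lra. }
  nra.
Qed.

(** A bound by [M exp (- t)] is enough for all integrals here, because their
    integrands decay doubly exponentially; it makes the Cauchy criterion and all
    estimates explicit. *)
Lemma is_ray_exists f a M :
  (forall t, a <= t -> continuous f t) ->
  (forall t, a <= t -> Cmod (f t) <= M * exp (- t)) -> exists l, is_ray f a l.
Proof.
  intros Cf B.
  set (J := fun T => RIntC f a T).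
  assert (HJ : forall S T, a <= S <= T -> is_RIntC f S T (RIntC f S T)).
  { intros S T HT. apply RIntC_correct; [lra|]. intros t Ht; apply Cf; lra. }
  assert (M0 : 0 <= M).
  { pose proof (B a (Rle_refl a)). pose proof (Cmod_ge_0 (f a)). pose proof (exp_pos (- a)). nra. }
  assert (Cau : forall S T, a <= S <= T -> Cmod (J T - J S) <= M * exp (- S)).
  { intros S T HST.
    assert (E : (J S + RIntC f S T = J T)%C).
    { eapply is_RIntC_unique.
      - apply (is_RIntC_Chasles f a S T); apply HJ; lra.
      - apply HJ; lra. }
    rewrite <- E. replace (J S + _ - J S)%C with (RIntC f S T) by ring.
    apply Rle_trans with (M * (exp (- S) - exp (- T))).
    - apply (Cmod_RInt_le f (fun t => M * exp (- t)) S T); [lra| | |apply is_RInt_exp_opp].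
      + intros t Ht; apply B; lra.
      + now apply HJ.
    - pose proof (exp_pos (- T)). nra. }
  assert (Z := tends_to_exp_bound (fun T => RtoC (M * exp (- T))) M a).
  destruct (proj1 (filterlim_locally_cauchy (U := C_R_CompleteNormedModule) (F := Rbar_locally p_infty) J)) as [l Hl].
  - intros [e He].
    destruct (Z) with (e := e) as [T0 HT0]; [|assumption|].
    { intros T _. rewrite Cmod_R, Rabs_pos_eq; [lra|]. pose proof (exp_pos (- T)); nra. }
    exists (fun T => Rmax a T0 < T). split; [now exists (Rmax a T0)|].
    assert (W : forall S T, Rmax a T0 < S -> S <= T -> Cmod (J T - J S) < e).
    { intros S T HS HT.
      assert (a < S) by (eapply Rle_lt_trans; [apply Rmax_l|exact HS]).
      assert (T0 < S) by (eapply Rle_lt_trans; [apply Rmax_r|exact HS]).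
      eapply Rle_lt_trans; [apply Cau; lra|].
      specialize (HT0 S ltac:(lra)). replace (RtoC (M * exp (- S)) - 0)%C with (RtoC (M * exp (- S))) in HT0 by ring.
      rewrite Cmod_R, Rabs_pos_eq in HT0; [lra|]. pose proof (exp_pos (- S)); nra. }
    intros S T HS HT. apply ball_Cmod. simpl.
    destruct (Rle_dec S T) as [L|L].
    + now apply W.
    + rewrite <- Cmod_opp. replace (- (J T - J S))%C with (J S - J T)%C by ring. apply W; lra.
  - exists l. exists J. split.
    + intros T HT. apply HJ. lra.
    + intros e He.
      assert (He' : 0 < e / 2) by lra.
      destruct (proj1 (filterlim_locally J l) Hl (mkposreal _ He')) as [T0 HT0].
      exists (T0 + 1). intros T HT. specialize (HT0 T ltac:(lra)).
      apply Cmod_ball in HT0. simpl in HT0. lra.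
Qed.

Lemma is_ray_derive (F f : R -> C) a :
  (forall t, a <= t -> cderive F t (f t)) -> (forall t, a <= t -> continuous f t) ->
  tends_to F 0 -> is_ray f a (- F a)%C.
Proof.
  intros D Cf L. exists (fun T => F T + - F a)%C. split.
  - intros T HT. apply is_RIntC_derive; [assumption| |]; intros t Ht; [apply D|apply Cf]; lra.
  - pose proof (tends_to_plus F _ 0 _ L (tends_to_const (- F a)%C)) as K.
    rewrite Cplus_0_l in K. exact K.
Qed.

Lemma is_ray_RInt_gen f a l : is_ray f a l ->
  is_RInt_gen (V := C_R_NormedModule) f (at_point a) (Rbar_locally p_infty) l.
Proof.
  intros (J & H1 & H2) P [e HP].
  destruct (H2 e (cond_pos e)) as [T0 HT0].
  unfold filtermapi.
  apply (Filter_prod _ _ _ (fun x => x = a) (fun T => Rmax a T0 < T)).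
  - reflexivity.
  - now exists (Rmax a T0).
  - intros x T -> HT. exists (J T). simpl.
    assert (a < T) by (eapply Rle_lt_trans; [apply Rmax_l|exact HT]).
    assert (T0 < T) by (eapply Rle_lt_trans; [apply Rmax_r|exact HT]).
    split; [apply H1; lra|]. apply HP. apply ball_Cmod. apply HT0; lra.
Qed.


(** * Integrals along Hankel contours *)

(** The integral along a Hankel contour, seen in the coordinate v = log u: the rays
    become horizontal half-lines, and the arc a vertical segment on which
    dv = i dy. *)
Definition is_hankel (G : C -> C) (t0 theta : R) (l : C) : Prop :=
  exists l1 l2 l3,
    is_ray (fun t => G (t, - theta)) t0 l1 /\
    is_RIntC (fun y => G (t0, y)) (- theta) theta l2 /\
    is_ray (fun t => G (t, theta)) t0 l3 /\
    l = (- l1 + Ci * l2 + l3)%C.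

Lemma is_hankel_unique G t0 theta l l' : is_hankel G t0 theta l -> is_hankel G t0 theta l' -> l = l'.
Proof.
  intros (a & b & c & A & B & D & ->) (a' & b' & c' & A' & B' & D' & ->).
  rewrite (is_ray_unique _ _ _ _ A A'), (is_ray_unique _ _ _ _ D D'), (is_RIntC_unique _ _ _ _ _ B B').
  reflexivity.
Qed.

Lemma is_hankel_plus F G t0 theta k l : is_hankel F t0 theta k -> is_hankel G t0 theta l ->
  is_hankel (fun v => F v + G v)%C t0 theta (k + l)%C.
Proof.
  intros (a & b & c & A & B & D & ->) (a' & b' & c' & A' & B' & D' & ->).
  exists (a + a')%C, (b + b')%C, (c + c')%C; repeat split.
  - now apply (is_ray_plus (fun t => F (t, - theta)) (fun t => G (t, - theta))).
  - now apply (is_RIntC_plus (fun y => F (t0, y)) (fun y => G (t0, y))).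
  - now apply (is_ray_plus (fun t => F (t, theta)) (fun t => G (t, theta))).
  - ring.
Qed.

Lemma is_hankel_Cmult k G t0 theta l : is_hankel G t0 theta l ->
  is_hankel (fun v => k * G v)%C t0 theta (k * l)%C.
Proof.
  intros (a & b & c & A & B & D & ->).
  exists (k * a)%C, (k * b)%C, (k * c)%C; repeat split.
  - now apply (is_ray_Cmult k (fun t => G (t, - theta))).
  - now apply (is_RIntC_Cmult k (fun y => G (t0, y))).
  - now apply (is_ray_Cmult k (fun t => G (t, theta))).
  - ring.
Qed.

Definition on_path (t0 theta : R) (v : C) : Prop :=
  (t0 <= Re v /\ (Im v = theta \/ Im v = - theta)) \/ (Re v = t0 /\ - theta <= Im v <= theta).

Lemma is_hankel_ext F G t0 theta l : 0 <= theta ->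
  (forall v, on_path t0 theta v -> F v = G v) ->
  is_hankel F t0 theta l -> is_hankel G t0 theta l.
Proof.
  intros th E (a & b & c & A & B & D & ->). exists a, b, c; repeat split.
  - apply (is_ray_ext (fun t => F (t, - theta))); [|assumption].
    intros t Ht; apply E; left; simpl; auto.
  - apply (is_RIntC_ext (fun t => F (t0, t))); [lra| |assumption].
    intros t Ht; apply E; right; simpl; auto.
  - apply (is_ray_ext (fun t => F (t, theta))); [|assumption].
    intros t Ht; apply E; left; simpl; auto.
Qed.

(** The segment gets a bound of its own, since in Laplace's method its
    contribution is much smaller than length times maximum. *)
Lemma hankel_bound_arc G t0 theta l M g B :
  0 <= theta ->
  (forall t, t0 <= t -> Cmod (G (t, theta)) <= M * exp (- t)) ->
  (forall t, t0 <= t -> Cmod (G (t, - theta)) <= M * exp (- t)) ->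
  (forall y, - theta <= y <= theta -> Cmod (G (t0, y)) <= g y) ->
  is_RInt g (- theta) theta B ->
  is_hankel G t0 theta l -> Cmod l <= 2 * M * exp (- t0) + B.
Proof.
  intros th H1 H2 H3 HB (a & b & c & A & A2 & D & ->).
  apply (is_ray_bound _ _ _ _ H2) in A. apply (is_ray_bound _ _ _ _ H1) in D.
  assert (A3 : Cmod b <= B) by (apply (Cmod_RInt_le (fun y => G (t0, y)) g (- theta) theta); [lra|exact H3|exact A2|exact HB]).
  eapply Rle_trans; [apply Cmod_triangle|].
  eapply Rle_trans; [apply Rplus_le_compat_r; apply Cmod_triangle|].
  rewrite Cmod_opp, Cmod_mult, Cmod_Ci. lra.
Qed.

Lemma hankel_bound G t0 theta l M :
  0 <= theta ->
  (forall v, on_path t0 theta v -> Cmod (G v) <= M * exp (- Re v)) ->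
  is_hankel G t0 theta l -> Cmod l <= (2 + 2 * theta) * (M * exp (- t0)).
Proof.
  intros th H L.
  eapply Rle_trans; [eapply hankel_bound_arc with (M := M) (g := fun _ => M * exp (- t0)); try eassumption|].
  - intros t Ht. apply (H (t, theta)). left; simpl; auto.
  - intros t Ht. apply (H (t, - theta)). left; simpl; auto.
  - intros y Hy. apply (H (t0, y)). right; simpl; auto.
  - apply (is_RInt_const (V := R_NormedModule)).
  - unfold scal; simpl; unfold mult; simpl. right; ring.
Qed.

Lemma hankel_exists G t0 theta M :
  0 <= theta ->
  (forall v, on_path t0 theta v -> continuous G v) ->
  (forall v, on_path t0 theta v -> Cmod (G v) <= M * exp (- Re v)) ->
  exists l, is_hankel G t0 theta l.
Proof.
  intros th HC H.
  destruct (is_ray_exists (fun t => G (t, - theta)) t0 M) as [a A].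
  - intros t Ht. apply continuous_hor, HC. left; simpl; auto.
  - intros t Ht. apply (H (t, - theta)). left; simpl; auto.
  - destruct (is_ray_exists (fun t => G (t, theta)) t0 M) as [c D].
    + intros t Ht. apply continuous_hor, HC. left; simpl; auto.
    + intros t Ht. apply (H (t, theta)). left; simpl; auto.
    + exists (- a + Ci * arc G (- theta) theta t0 + c)%C.
      exists a, (arc G (- theta) theta t0), c. repeat split; try assumption.
      apply arc_correct; [lra|]. intros y Hy. apply HC. right; simpl; auto.
Qed.

(** The radius of the circular arc does not matter as long as no singularity is
    crossed: the two contours differ by the boundary of a rectangle. *)
Lemma hankel_move G lo t0 t1 theta l :
  0 <= theta -> lo < t0 <= t1 ->
  (forall s y, lo < s -> - theta <= y <= theta -> holo G (s, y)) ->
  is_hankel G t1 theta l -> is_hankel G t0 theta l.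
Proof.
  intros th lot H (a & b & c & A & B & D & ->).
  assert (HC : forall s y, lo < s -> - theta <= y <= theta -> continuous G (s, y)).
  { intros; apply holo_continuous; now apply H. }
  assert (R := Cauchy_rectangle G (- theta) theta lo t0 t1 ltac:(lra) lot H).
  assert (K : forall y, - theta <= y <= theta -> forall t, t0 <= t -> continuous (fun t => G (t, y)) t).
  { intros y Hy t Ht. apply continuous_hor, HC; lra. }
  assert (K1 := K theta ltac:(lra)). assert (K2 := K (- theta) ltac:(lra)).
  assert (R1 := RIntC_correct (fun t => G (t, theta)) t0 t1 ltac:(lra) ltac:(intros; apply K1; lra)).
  assert (R2 := RIntC_correct (fun t => G (t, - theta)) t0 t1 ltac:(lra) ltac:(intros; apply K2; lra)).
  set (r1 := RIntC (fun t => G (t, theta)) t0 t1) in *.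
  set (r2 := RIntC (fun t => G (t, - theta)) t0 t1) in *.
  assert (E : (r1 - r2 = Ci * arc G (- theta) theta t1 - Ci * arc G (- theta) theta t0)%C).
  { eapply is_RIntC_unique; [|exact R]. apply (is_RInt_minus (V := C_R_NormedModule) _ _ _ _ _ _ R1 R2). }
  assert (E1 : arc G (- theta) theta t1 = b).
  { eapply is_RIntC_unique; [|exact B]. apply arc_correct; [lra|]. intros; apply HC; lra. }
  exists (r2 + a)%C, (arc G (- theta) theta t0), (r1 + c)%C. repeat split.
  - apply (is_ray_back _ t0 t1); auto; lra.
  - apply arc_correct; [lra|]. intros; apply HC; lra.
  - apply (is_ray_back _ t0 t1); auto; lra.
  - rewrite E1 in E. transitivity (- a + (r1 - r2 + Ci * arc G (- theta) theta t0) + c)%C; [rewrite E|]; ring.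
Qed.

(** A derivative integrates to zero because its primitive vanishes at both ends
    of the contour; this is integration by parts for Hankel integrals. *)
Lemma hankel_derive G G' t0 theta M :
  0 <= theta ->
  (forall v, on_path t0 theta v -> curve_deriv G v (G' v)) ->
  (forall v, on_path t0 theta v -> continuous G' v) ->
  (forall v, on_path t0 theta v -> Cmod (G v) <= M * exp (- Re v)) ->
  is_hankel G' t0 theta 0.
Proof.
  intros th D HC B.
  assert (L : forall y, y = theta \/ y = - theta -> is_ray (fun t => G' (t, y)) t0 (- G (t0, y))%C).
  { intros y Hy. apply (is_ray_derive (fun t => G (t, y))).
    - intros t Ht. eapply cderive_eq.
      + apply (D (t, y)) with (c := fun t => (t, y)); [left; simpl; auto|reflexivity|apply cderive_hor].
      + ring.
    - intros t Ht. apply continuous_hor, HC. left; simpl; auto.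
    - apply (tends_to_exp_bound _ M t0). intros T HT. apply (B (T, y)). left; simpl; auto. }
  assert (Ar : is_RIntC (fun y => Ci * G' (t0, y))%C (- theta) theta (G (t0, theta) - G (t0, (- theta)%R))%C).
  { apply (is_RIntC_derive (fun y => G (t0, y))); [lra| |].
    - intros y Hy. apply (D (t0, y)) with (c := fun y => (t0, y)); [right; simpl; auto|reflexivity|apply cderive_ver].
    - intros y Hy. apply (continuous_ver (fun v => Ci * G' v)%C). apply continuous_Cmult; [apply continuous_const|].
      apply HC. right; simpl; auto. }
  apply (is_RIntC_Cmult (- Ci)%C) in Ar.
  assert (I : (- Ci * Ci = 1)%C) by (apply injective_projections; simpl; ring).
  exists (- G (t0, (- theta)%R))%C, (- Ci * (G (t0, theta) - G (t0, (- theta)%R)))%C, (- G (t0, theta))%C.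
  repeat split; auto.
  - eapply is_RIntC_ext; [lra| |exact Ar]. intros t _. cbv beta.
    transitivity (- Ci * Ci * G' (t0, t))%C; [ring|]. rewrite I; ring.
  - transitivity (G (t0, (- theta)%R) + (- Ci * Ci) * (G (t0, theta) - G (t0, (- theta)%R)) - G (t0, theta))%C.
    + rewrite I; ring.
    + ring.
Qed.

(** Cauchy's theorem on an infinite half-strip: the far vertical side
    contributes nothing in the limit. *)
Lemma ray_strip G lo a b t0 M :
  a <= b -> lo < t0 ->
  (forall s y, lo < s -> a <= y <= b -> holo G (s, y)) ->
  (forall t y, t0 <= t -> a <= y <= b -> Cmod (G (t, y)) <= M * exp (- t)) ->
  is_ray (fun t => G (t, b) - G (t, a))%C t0 (- (Ci * arc G a b t0))%C.
Proof.
  intros ab lot H B. assert (HC : forall s y, lo < s -> a <= y <= b -> continuous G (s, y)).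
  { intros; apply holo_continuous; now apply H. }
  apply (is_ray_derive (fun s => Ci * arc G a b s)%C).
  - intros t Ht. apply arc_derive with lo; [assumption|lra|assumption].
  - intros t Ht. apply continuous_Cminus; apply continuous_hor, HC; lra.
  - apply (tends_to_exp_bound _ ((b - a) * M) t0). intros T HT.
    rewrite Cmod_mult, Cmod_Ci, Rmult_1_l.
    apply (Cmod_RInt_le (fun y => G (T, y)) (fun _ => M * exp (- T)) a b); [assumption| | |].
    + intros y Hy; auto.
    + apply arc_correct; [assumption|]. intros; apply HC; lra.
    + replace ((b - a) * M * exp (- T)) with (scal (b - a) (M * exp (- T))) by (unfold scal; simpl; unfold mult; simpl; ring).
      apply (is_RInt_const (V := R_NormedModule)).
Qed.

(** Both rays may be turned from the larger angle to the smaller one, through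
    sectors in which the function decays. *)
Lemma hankel_rotate G lo theta theta' t0 M l :
  0 <= theta <= theta' -> lo < t0 ->
  (forall s y, lo < s -> - theta' <= y <= theta' -> holo G (s, y)) ->
  (forall t y, t0 <= t -> theta <= Rabs y <= theta' -> Cmod (G (t, y)) <= M * exp (- t)) ->
  is_hankel G t0 theta' l -> is_hankel G t0 theta l.
Proof.
  intros th lot H B (a & b & c & A & A2 & D & ->).
  assert (HC : forall s y, lo < s -> - theta' <= y <= theta' -> continuous G (s, y)).
  { intros; apply holo_continuous; now apply H. }
  assert (S1 := ray_strip G lo theta theta' t0 M ltac:(lra) lot ltac:(intros; apply H; lra)
     ltac:(intros t y Ht Hy; apply B; [lra|rewrite Rabs_pos_eq; lra])).
  assert (S2 := ray_strip G lo (- theta') (- theta) t0 M ltac:(lra) lot ltac:(intros; apply H; lra)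
     ltac:(intros t y Ht Hy; apply B; [lra|rewrite Rabs_left1; lra])).
  assert (P : forall a b, - theta' <= a -> a <= b -> b <= theta' -> is_RIntC (fun y => G (t0, y)) a b (arc G a b t0)).
  { intros. apply arc_correct; [lra|]. intros; apply HC; lra. }
  assert (P1 := P (- theta') (- theta) ltac:(lra) ltac:(lra) ltac:(lra)).
  assert (P2 := P (- theta) theta ltac:(lra) ltac:(lra) ltac:(lra)).
  assert (P3 := P theta theta' ltac:(lra) ltac:(lra) ltac:(lra)).
  assert (E := is_RIntC_unique _ _ _ _ _ (is_RIntC_Chasles _ _ _ _ _ _ (is_RIntC_Chasles _ _ _ _ _ _ P1 P2) P3) A2).
  exists (a + - (Ci * arc G (- theta')%R (- theta)%R t0))%C, (arc G (- theta)%R theta t0),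
    (c + (- (1)) * - (Ci * arc G theta theta' t0))%C. repeat split.
  - eapply is_ray_ext; [|apply (is_ray_plus _ _ _ _ _ A S2)]. intros t _; cbv beta; ring.
  - assumption.
  - eapply is_ray_ext; [|apply (is_ray_plus _ _ _ _ _ D (is_ray_Cmult (- (1))%C _ _ _ S1))]. intros t _; cbv beta; ring.
  - rewrite <- E. ring.
Qed.

(** * The Hankel kernel *)

(** The form e^u u^(-w) du in the coordinate v = log u, where u^(-w) du becomes
    exp ((1 - w) v) dv. *)
Definition hankel_kernel (w v : C) : C := Cexp (Cexp v + (1 - w) * v)%C.

Lemma holo_hankel_kernel w v : holo (hankel_kernel w) v.
Proof.
  unfold hankel_kernel. apply (holo_Cexp (fun v => Cexp v + (1 - w) * v)%C).
  apply (holo_plus (fun v => Cexp v) (fun v => (1 - w) * v)%C).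
  - apply holo_Cexp, holo_id.
  - apply (holo_mult (fun _ => (1 - w)%C) (fun v => v)); [apply holo_const|apply holo_id].
Qed.

Lemma Cmod_hankel_kernel w t y : Cmod (hankel_kernel w (t, y)) = exp (exp t * cos y + (1 - Re w) * t + Im w * y).
Proof. unfold hankel_kernel. rewrite Cmod_Cexp. f_equal. unfold Re, Im; simpl. ring. Qed.

Lemma exp_le (x y : R) : x <= y -> exp x <= exp y.
Proof. intros [H| ->]; [left; now apply exp_increasing|right; reflexivity]. Qed.

(** The exponential lies above its tangent at the point where
    [c * exp] has slope [k + 1]; if [k + 1 <= 0] there is no such point, and
    - c e^t + (k + 1) t is non-increasing. *)
Lemma exp_double_decay c k t0 : 0 < c -> exists M, forall t, t0 <= t -> exp (- c * exp t + k * t) <= M * exp (- t).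
Proof.
  intro Hc.
  assert (E : exists N, forall t, t0 <= t -> - c * exp t + (k + 1) * t <= N).
  { destruct (Rle_dec (k + 1) 0) as [Hk|Hk].
    - exists ((k + 1) * t0). intros t Ht. pose proof (exp_pos t). nra.
    (* abscissa of the tangent point *)
    - set (s := ln ((k + 1) / c)). exists ((k + 1) * s).
      assert (P : 0 < (k + 1) / c) by (apply Rdiv_lt_0_compat; lra).
      assert (Es : exp s = (k + 1) / c) by now apply exp_ln.
      intros t Ht.
      assert (exp t = exp s * exp (t - s)) by (rewrite <- exp_plus; f_equal; ring).
      assert (c * exp t = (k + 1) * exp (t - s)) by (rewrite H, Es; field; lra).
      pose proof (exp_ineq1_le (t - s)). nra. }
  destruct E as [N HN]. exists (exp N). intros t Ht.
  rewrite <- exp_plus. apply exp_le. specialize (HN t Ht). lra.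
Qed.

Lemma cos_le_abs theta0 y : PI / 2 < theta0 -> theta0 <= Rabs y <= PI -> cos y <= cos theta0.
Proof.
  intros H [H1 H2]. pose proof PI_RGT_0.
  assert (cos y = cos (Rabs y)) as ->.
  { unfold Rabs; destruct (Rcase_abs y); [now rewrite cos_neg|reflexivity]. }
  apply cos_decr_1; lra.
Qed.

Lemma hankel_kernel_ray_bound w theta0 t0 : PI / 2 < theta0 <= PI ->
  exists M, forall t y, t0 <= t -> theta0 <= Rabs y <= PI -> Cmod (hankel_kernel w (t, y)) <= M * exp (- t).
Proof.
  intros Hth. pose proof PI_RGT_0.
  assert (c0 : 0 < - cos theta0) by (pose proof (cos_lt_0 theta0); lra).
  destruct (exp_double_decay (- cos theta0) (1 - Re w) t0 c0) as [M HM].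
  exists (exp (Rabs (Im w) * PI) * M). intros t y Ht Hy.
  rewrite Cmod_hankel_kernel. rewrite Rmult_assoc. eapply Rle_trans; [|apply Rmult_le_compat_l; [left; apply exp_pos|apply HM; exact Ht]].
  rewrite <- exp_plus. apply exp_le.
  pose proof (cos_le_abs theta0 y ltac:(lra) Hy). pose proof (exp_pos t).
  assert (Im w * y <= Rabs (Im w) * PI).
  { eapply Rle_trans; [apply Rle_abs|]. rewrite Rabs_mult. apply Rmult_le_compat_l; [apply Rabs_pos|lra]. }
  nra.
Qed.

Lemma hankel_kernel_path_bound w theta t0 : PI / 2 < theta <= PI ->
  exists M, forall v, on_path t0 theta v -> Cmod (hankel_kernel w v) <= M * exp (- Re v).
Proof.
  intros Hth. pose proof PI_RGT_0.
  destruct (hankel_kernel_ray_bound w theta t0 Hth) as [M HM].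
  set (A := exp (exp t0 + (1 - Re w) * t0 + Rabs (Im w) * PI) * exp t0).
  assert (M0 : 0 <= M).
  { pose proof (HM t0 theta ltac:(lra) ltac:(rewrite Rabs_pos_eq; lra)).
    pose proof (Cmod_ge_0 (hankel_kernel w (t0, theta))). pose proof (exp_pos (- t0)). nra. }
  assert (A0 : 0 < A) by (unfold A; apply Rmult_lt_0_compat; apply exp_pos).
  (* M controls the rays and A the vertical segment *)
  exists (M + A). intros [t y] [[Ht Hy]|[Ht Hy]]; simpl in *.
  - pose proof (exp_pos (- t)). apply Rle_trans with (M * exp (- t)); [|nra].
    apply HM; [exact Ht|]. destruct Hy as [-> | ->]; [|rewrite Rabs_Ropp]; rewrite Rabs_pos_eq; lra.
  - subst t. pose proof (exp_pos (- t0)). apply Rle_trans with (A * exp (- t0)); [|nra].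
    unfold A. rewrite Rmult_assoc, <- (exp_plus t0). replace (t0 + - t0) with 0 by ring.
    rewrite exp_0, Rmult_1_r, Cmod_hankel_kernel. apply exp_le.
    pose proof (COS_bound y). pose proof (exp_pos t0).
    assert (Im w * y <= Rabs (Im w) * PI).
    { eapply Rle_trans; [apply Rle_abs|]. rewrite Rabs_mult. apply Rmult_le_compat_l; [apply Rabs_pos|].
      apply Rabs_le; lra. }
    nra.
Qed.

Lemma hankel_kernel_integrable w theta t0 : PI / 2 < theta <= PI -> exists l, is_hankel (hankel_kernel w) t0 theta l.
Proof.
  intros Hth. pose proof PI_RGT_0. destruct (hankel_kernel_path_bound w theta t0 Hth) as [M HM].
  apply hankel_exists with M; [lra| |assumption]. intros; apply holo_continuous, holo_hankel_kernel.
Qed.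

Lemma hankel_kernel_move w theta t0 t1 l : PI / 2 < theta <= PI ->
  is_hankel (hankel_kernel w) t0 theta l -> is_hankel (hankel_kernel w) t1 theta l.
Proof.
  intros Hth H. pose proof PI_RGT_0. 
  assert (D : forall a b k, a <= b -> is_hankel (hankel_kernel w) b theta k -> is_hankel (hankel_kernel w) a theta k).
  { intros a b k ab Hk. apply (hankel_move _ (a - 1) a b); auto; try lra. intros; apply holo_hankel_kernel. }
  destruct (Rle_dec t1 t0) as [L|L]; [now apply D with t0|].
  destruct (hankel_kernel_integrable w theta t1 Hth) as [k Hk].
  assert (is_hankel (hankel_kernel w) t0 theta k) by (apply D with t1; [lra|assumption]).
  now rewrite (is_hankel_unique _ _ _ _ _ H H1).
Qed.

(** Integration by parts: u^(-w) e^u - w u^(-w-1) e^u is the derivative of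
    u^(-w) e^u. This mirrors 1/Gamma(w) = w/Gamma(w+1). *)
Lemma hankel_kernel_rec w theta t0 l : PI / 2 < theta <= PI ->
  is_hankel (hankel_kernel (w + 1)) t0 theta l -> is_hankel (hankel_kernel w) t0 theta (w * l)%C.
Proof.
  intros Hth H. pose proof PI_RGT_0.
  destruct (hankel_kernel_path_bound (w + 1) theta t0 Hth) as [M HM].
  assert (Z : is_hankel (fun v => (Cexp v + (1 - (w + 1))) * hankel_kernel (w + 1) v)%C t0 theta 0).
  { apply (hankel_derive (hankel_kernel (w + 1)) _ t0 theta M); [lra| | |assumption].
    - intros v _ c x c' E D. unfold hankel_kernel. eapply cderive_eq.
      + apply cderive_exp. apply (cderive_plus (fun t => Cexp (c t)) (fun t => (1 - (w + 1)) * c t)%C).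
        * apply cderive_exp; exact D.
        * apply cderive_mult; [apply cderive_const|exact D].
      + cbv beta. rewrite E. ring.
    - intros v _. apply continuous_Cmult; [|apply holo_continuous, holo_hankel_kernel].
      apply continuous_Cplus; [apply continuous_Cexp, continuous_id|apply continuous_const]. }
  assert (Z2 := is_hankel_plus _ _ _ _ _ _ Z (is_hankel_Cmult w _ _ _ _ H)).
  rewrite Cplus_0_l in Z2. revert Z2. apply is_hankel_ext; [lra|].
  intros v _. cbv beta. unfold hankel_kernel.
  replace (Cexp v + (1 - w) * v)%C with (v + (Cexp v + (1 - (w + 1)) * v))%C by ring.
  rewrite (Cexp_plus v). ring.
Qed.

(** Integrate the derivative of [s |-> Cexp (s * z)] over [0, 1]. *)
Lemma Cmod_Cexp_minus_1_le z : Cmod (Cexp z - 1) <= Cmod z * exp (Cmod z).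
Proof.
  assert (H : is_RIntC (fun s : R => z * Cexp (s * z))%C 0 1 (Cexp (1 * z) - Cexp (0 * z))%C).
  { apply (is_RIntC_derive (fun s : R => Cexp (s * z))%C); [lra| |].
    - intros s _. eapply cderive_eq.
      + apply cderive_exp. apply cderive_mult; [|apply cderive_const]. apply (cderive_hor 0).
      + cbv beta. ring.
    - intros s _. apply continuous_Cmult; [apply continuous_const|apply continuous_Cexp].
      apply continuous_Cmult; [|apply continuous_const].
      apply continuous_pairC; simpl; [apply continuous_id|apply continuous_const]. }
  rewrite Cmult_1_l, Cmult_0_l, Cexp_0 in H.
  replace (Cmod z * exp (Cmod z)) with (scal (1 - 0) (Cmod z * exp (Cmod z)))
    by (unfold scal; simpl; unfold mult; simpl; ring).
  apply (Cmod_RInt_le (fun s : R => z * Cexp (s * z))%C (fun _ => Cmod z * exp (Cmod z)) 0 1); [lra| |exact H|apply (is_RInt_const (V := R_NormedModule))].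
  intros s Hs. rewrite Cmod_mult, Cmod_Cexp. apply Rmult_le_compat_l; [apply Cmod_ge_0|].
  apply exp_le. assert (Re (s * z)%C = s * Re z) as -> by (unfold Re; simpl; ring).
  pose proof (Rle_abs (Re z)). pose proof (Rmax_Cmod z). pose proof (Rmax_l (Rabs (fst z)) (Rabs (snd z))).
  unfold Re in *. pose proof (Cmod_ge_0 z). nra.
Qed.

Lemma scal_RtoC (k : R) (z : C) : @eq C (scal (V := C_R_NormedModule) k z) (k * z)%C.
Proof.
  apply injective_projections; unfold Cmult; simpl; unfold scal; simpl; unfold mult; simpl.
  - rewrite Rmult_0_l, Rminus_0_r. reflexivity.
  - rewrite Rmult_0_l, Rplus_0_r. reflexivity.
Qed.

(** On the keyhole contour the two rays cancel, since e^u/u is single-valued. The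
    circle contributes the integral of exp (u), which tends to 2 pi as the circle
    shrinks, while the total does not depend on its radius. *)
Lemma hankel_kernel_1_keyhole t0 : is_hankel (hankel_kernel 1) t0 PI (2 * PI * Ci)%C.
Proof.
  pose proof PI_RGT_0. pose proof PI_4.
  assert (Hth : PI / 2 < PI <= PI) by lra.
  destruct (hankel_kernel_integrable 1 PI t0 Hth) as [l Hl].
  replace (2 * PI * Ci)%C with l; [assumption|].
  assert (B : forall t, Cmod (l - 2 * PI * Ci) <= 2 * PI * (exp t * exp (exp t))).
  { intro t. apply (hankel_kernel_move 1 PI t0 t l Hth) in Hl.
    destruct Hl as (a & b & c & A & Bb & D & ->).
    assert (c = a) as ->.
    { apply (is_ray_unique _ _ _ _ D). apply (is_ray_ext (fun t => hankel_kernel 1 (t, - PI))); [|assumption].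
      intros s _. unfold hankel_kernel. f_equal. unfold Cexp; simpl. rewrite cos_neg, sin_neg, cos_PI, sin_PI.
      apply injective_projections; simpl; ring. }
    assert (Cst : is_RIntC (fun _ => (- (1))%C) (- PI) PI (- (2 * PI))%C).
    { assert (E : ((PI - - PI)%R * (- (1)) = - (2 * PI))%C) by (apply injective_projections; simpl; ring).
      rewrite <- E, <- scal_RtoC. apply (is_RInt_const (V := C_R_NormedModule)). }
    replace (- a + Ci * b + a - 2 * PI * Ci)%C with (Ci * (b + - (2 * PI)))%C by ring.
    rewrite Cmod_mult, Cmod_Ci, Rmult_1_l.
    replace (2 * PI * (exp t * exp (exp t))) with (scal (PI - - PI) (exp t * exp (exp t)))
      by (unfold scal; simpl; unfold mult; simpl; ring).
    eapply (Cmod_RInt_le _ (fun _ => exp t * exp (exp t)) (- PI) PI); [lra| |apply (is_RIntC_plus _ _ _ _ _ _ Bb Cst)|apply (is_RInt_const (V := R_NormedModule))].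
    intros y _. cbv beta. unfold hankel_kernel.
    replace (Cexp (t, y) + (1 - 1) * (t, y))%C with (Cexp (t, y)) by ring.
    eapply Rle_trans; [apply Cmod_Cexp_minus_1_le|]. rewrite Cmod_Cexp. simpl. lra. }
  apply Ceq_lim. intros e He.
  (* for t <= 0 the bound is at most 2 PI * 3 exp t <= 24 exp t *)
  set (t := Rmin 0 (ln (e / 25))).
  assert (P : 0 < e / 25) by lra.
  assert (T1 : exp t <= 1) by (rewrite <- exp_0; apply exp_le, Rmin_l).
  assert (T2 : exp t <= e / 25) by (rewrite <- (exp_ln _ P); apply exp_le, Rmin_r).
  assert (T3 : exp (exp t) <= 3) by (eapply Rle_trans; [apply exp_le, T1|apply exp_le_3]).
  eapply Rle_lt_trans; [apply (B t)|].
  pose proof (exp_pos t). pose proof (exp_pos (exp t)).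
  assert (exp t * exp (exp t) <= e / 25 * 3) by (apply Rmult_le_compat; lra).
  assert (2 * PI * (exp t * exp (exp t)) <= 8 * (e / 25 * 3)) by (apply Rmult_le_compat; try lra; nra).
  lra.
Qed.

Lemma hankel_kernel_1 theta t0 : PI / 2 < theta <= PI -> is_hankel (hankel_kernel 1) t0 theta (2 * PI * Ci)%C.
Proof.
  intro Hth. pose proof PI_RGT_0.
  destruct (hankel_kernel_ray_bound 1 theta t0 Hth) as [M HM].
  apply (hankel_rotate (hankel_kernel 1) (t0 - 1) theta PI t0 M); try lra.
  - intros; apply holo_hankel_kernel.
  - exact HM.
  - apply hankel_kernel_1_keyhole.
Qed.

Lemma RtoC_inj_neq (x y : R) : x <> y -> RtoC x <> RtoC y.
Proof. intros H E. now apply H, RtoC_inj. Qed.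

Lemma INR_fact_neq_0_C n : RtoC (INR (fact n)) <> 0.
Proof. intro E. apply RtoC_inj in E. now apply (INR_fact_neq_0 n). Qed.

Lemma hankel_kernel_nat n theta t0 : PI / 2 < theta <= PI ->
  is_hankel (hankel_kernel (INR (S n))) t0 theta (2 * PI * Ci / INR (fact n))%C.
Proof.
  intro Hth. induction n as [|n IH].
  - simpl INR. replace (2 * PI * Ci / 1)%C with (2 * PI * Ci)%C by (field; apply RtoC_inj_neq; lra).
    now apply hankel_kernel_1.
  - destruct (hankel_kernel_integrable (INR (S (S n))) theta t0 Hth) as [l Hl].
    assert (H := hankel_kernel_rec (INR (S n)) theta t0 l Hth).
    rewrite <- RtoC_plus, <- S_INR in H.
    assert (E := is_hankel_unique _ _ _ _ _ IH (H Hl)).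
    replace (2 * PI * Ci / INR (fact (S n)))%C with l; [assumption|].
    rewrite fact_simpl, mult_INR, RtoC_mult.
    assert (N : RtoC (INR (S n)) <> 0) by (apply RtoC_inj_neq, not_0_INR; lia).
    pose proof (INR_fact_neq_0_C n).
    transitivity ((INR (S n) * l) / INR (S n))%C; [now field|]. rewrite <- E. field; auto.
Qed.

(** Iterating the recursion produces the numerator z (z+1) ... of Gauss's
    limit. *)
Lemma hankel_kernel_rising z n theta t0 l : PI / 2 < theta <= PI ->
  is_hankel (hankel_kernel (z + INR n)) t0 theta l -> is_hankel (hankel_kernel z) t0 theta (rising z n * l)%C.
Proof.
  intro Hth. revert l. induction n as [|n IH]; intros l H.
  - simpl in *. rewrite Cplus_0_r in H. now rewrite Cmult_1_l.
  - rewrite S_INR, RtoC_plus, Cplus_assoc in H.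
    apply hankel_kernel_rec, IH in H; [|assumption].
    simpl rising. now rewrite <- Cmult_assoc.
Qed.

(** * Hankel's formula for the reciprocal Gamma function *)

(** Equivalent to (1 + 1/x)^(x + 1/2) >= e, which is the monotonicity behind
    Stirling's formula. With u = 1/x it reads ln (1 + u) >= 2u/(2 + u), and the
    difference of the two sides increases from 0. *)
Lemma ln_succ_ge (x : R) : 0 < x -> 1 <= (x + / 2) * (ln (x + 1) - ln x).
Proof.
  intro Hx.
  set (f := fun u => ln (1 + u) - 2 * u / (2 + u)).
  assert (F : forall u, 0 <= u -> 0 <= f u).
  { intros u [Hu|<-].
    - destruct (MVT_gen f 0 u (fun u => u ^ 2 / ((1 + u) * (2 + u) ^ 2))) as [v [Hv E]].
      + rewrite Rmin_left, Rmax_right by lra. intros v Hv. unfold f.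
        auto_derive; [repeat split; lra|]. field; lra.
      + rewrite Rmin_left, Rmax_right by lra. intros v Hv.
        apply continuity_pt_filterlim.
        apply (ex_derive_continuous (V := R_NormedModule) f). unfold f. auto_derive. repeat split; lra.
      + rewrite Rmin_left, Rmax_right in Hv by lra.
        assert (f 0 = 0) by (unfold f; rewrite Rplus_0_r, ln_1; field).
        assert (0 <= v ^ 2 / ((1 + v) * (2 + v) ^ 2)).
        { apply Rdiv_le_0_compat; nra. }
        nra.
    - unfold f. rewrite Rplus_0_r, ln_1. right; field. }
  specialize (F (/ x) ltac:(left; now apply Rinv_0_lt_compat)). unfold f in F.
  assert (E : ln (x + 1) - ln x = ln (1 + / x)).
  { rewrite <- ln_div by lra. f_equal. field; lra. }
  rewrite E.
  assert (2 * / x / (2 + / x) = / (x + / 2)) by (field; lra).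
  rewrite H in F.
  apply Rle_trans with ((x + / 2) * / (x + / 2)); [right; field; lra|].
  apply Rmult_le_compat_l; lra.
Qed.

(** Laplace's method below yields an integral of order 1/n, so the factor in front
    of (n/e)^n has to be o(n); sqrt n is its true order. By induction, each step
    being [ln_succ_ge]. *)
Lemma stirling_upper n : (1 <= n)%nat ->
  INR (fact n) <= exp (INR n * ln (INR n) - INR n + ln (INR n) / 2 + 1).
Proof.
  intro Hn. induction n as [|n IH]; [lia|].
  destruct n as [|n].
  - simpl. rewrite ln_1. replace (1 * 0 - 1 + 0 / 2 + 1) with 0 by field. rewrite exp_0; lra.
  - specialize (IH ltac:(lia)). rewrite fact_simpl, mult_INR.
    set (N := S n) in *. assert (P : 0 < INR N) by (apply lt_0_INR; lia).
    assert (P' : 0 < INR (S N)) by (apply lt_0_INR; lia).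
    rewrite <- (exp_ln _ P') at 1.
    eapply Rle_trans; [apply Rmult_le_compat_l; [left; apply exp_pos|apply IH]|].
    rewrite <- exp_plus. apply exp_le.
    pose proof (ln_succ_ge _ P) as L. rewrite <- S_INR in L.
    set (L' := ln (INR (S N))) in *. rewrite S_INR. lra.
Qed.

Lemma fact_le_pow n : (1 <= n)%nat -> INR (fact n) <= exp (INR n * ln (INR n)).
Proof.
  intro Hn. eapply Rle_trans; [now apply stirling_upper|]. apply exp_le.
  assert (1 <= INR n) by (apply (le_INR 1); lia).
  assert (L : ln (INR n) <= INR n - 1).
  { pose proof (exp_ineq1_le (ln (INR n))). rewrite exp_ln in H0; lra. }
  lra.
Qed.

(** A quadratic bound valid up to the end points, from 1 - cos y = 2 sin^2 (y/2)
    and sin x >= x/3 on [0, 2]. *)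
Lemma cos_upper y : - PI <= y <= PI -> cos y <= 1 - y ^ 2 / 18.
Proof.
  assert (P : forall y, 0 <= y <= PI -> cos y <= 1 - y ^ 2 / 18).
  { intros u Hu. pose proof PI_4.
    replace u with (2 * (u / 2)) at 1 by field. rewrite cos_2a_sin.
    set (x := u / 2). assert (Hx : 0 <= x <= 2) by (unfold x; lra).
    assert (S : x / 3 <= sin x).
    { destruct (SIN x) as [S _]; [lra|unfold x; lra|].
      eapply Rle_trans; [|exact S]. unfold sin_lb, sin_approx, sin_term; simpl.
      assert (0 <= x ^ 2 <= 4) by nra.
      assert (0 <= x * (x^2)^2 * (42 - x^2)) by (apply Rmult_le_pos; [apply Rmult_le_pos; nra|nra]).
      assert (0 <= x * (4 - x^2)) by nra.
      nra. }
    assert (u = 2 * x) by (unfold x; field). nra. }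
  intros Hy. destruct (Rle_dec 0 y) as [L|L]; [apply P; lra|].
  rewrite <- cos_neg. replace (y ^ 2) with ((- y) ^ 2) by ring. apply P; lra.
Qed.

(** The weight |y| makes the Gaussian integral elementary. *)
Lemma is_RInt_abs_gauss k theta : 0 < k -> 0 <= theta ->
  exists B, is_RInt (fun y => Rabs y * exp (- k * y ^ 2)) (- theta) theta B /\ B <= / k.
Proof.
  intros Hk Ht.
  assert (D : forall s y, is_derive (fun y => s * - (/ (2 * k)) * exp (- k * y ^ 2)) y (s * y * exp (- k * y ^ 2))).
  { intros s y. auto_derive; [trivial|]. simpl. field. lra. }
  assert (Cn : forall s y, continuous (fun y => s * y * exp (- k * y ^ 2)) y).
  { intros s y. apply (ex_derive_continuous (V := R_NormedModule)). auto_derive; trivial. }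
  assert (I : forall s a b, is_RInt (fun y => s * y * exp (- k * y ^ 2)) a b
     (s * - (/ (2 * k)) * exp (- k * b ^ 2) - s * - (/ (2 * k)) * exp (- k * a ^ 2))).
  { intros s a b. apply (is_RInt_derive (V := R_CompleteNormedModule) (fun y => s * - (/ (2 * k)) * exp (- k * y ^ 2))); intros y _; [apply D|apply Cn]. }
  exists (/ k * (1 - exp (- k * theta ^ 2))). split.
  - assert (I1 : is_RInt (fun y => Rabs y * exp (- k * y ^ 2)) (- theta) 0 (/ (2 * k) * (1 - exp (- k * theta ^ 2)))).
    { apply (is_RInt_ext (fun y => - (1) * y * exp (- k * y ^ 2))).
      - intros y. rewrite Rmin_left, Rmax_right by lra. intros Hy. rewrite Rabs_left by lra.
        match goal with |- ?a = ?b => change (@eq R a b) end. ring.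
      - replace (/ (2 * k) * (1 - exp (- k * theta ^ 2))) with
          (- (1) * - (/ (2 * k)) * exp (- k * 0 ^ 2) - - (1) * - (/ (2 * k)) * exp (- k * (- theta) ^ 2)); [apply I|].
        replace ((- theta) ^ 2) with (theta ^ 2) by ring. replace (- k * 0 ^ 2) with 0 by ring.
        rewrite exp_0. ring. }
    assert (I2 : is_RInt (fun y => Rabs y * exp (- k * y ^ 2)) 0 theta (/ (2 * k) * (1 - exp (- k * theta ^ 2)))).
    { apply (is_RInt_ext (fun y => 1 * y * exp (- k * y ^ 2))).
      - intros y. rewrite Rmin_left, Rmax_right by lra. intros Hy. rewrite Rabs_pos_eq by lra.
        match goal with |- ?a = ?b => change (@eq R a b) end. ring.
      - replace (/ (2 * k) * (1 - exp (- k * theta ^ 2))) with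
          (1 * - (/ (2 * k)) * exp (- k * theta ^ 2) - 1 * - (/ (2 * k)) * exp (- k * 0 ^ 2)); [apply I|].
        replace (- k * 0 ^ 2) with 0 by ring. rewrite exp_0. ring. }
    replace (/ k * (1 - exp (- k * theta ^ 2))) with
      (plus (/ (2 * k) * (1 - exp (- k * theta ^ 2))) (/ (2 * k) * (1 - exp (- k * theta ^ 2))))
      by (unfold plus; simpl; field; lra).
    apply (is_RInt_Chasles _ _ _ _ _ _ I1 I2).
  - pose proof (exp_pos (- k * theta ^ 2)). assert (0 < / k) by now apply Rinv_0_lt_compat. nra.
Qed.

(** Laplace's method. Write h for the Hankel integral of u^(-z) e^u. By
    [hankel_kernel_rising] it is the term of Gauss's sequence times
    X = n! n^z l, with l the Hankel integral of u^(-z-n-1) e^u. For z = 0 the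
    value of X is exactly 2 pi i, and the difference has the integrand
    n! u^(-n-1) e^u ((u/n)^(-z) - 1). The arc of radius n passes through the
    saddle point u = n, where the last factor vanishes. With u = n e^(iy),
    Stirling's bound leaves C sqrt n |y| exp (- n y^2/18), whose integral is of
    order 1/sqrt n. On the rays n! u^(-n) is at most 1 in modulus and e^u decays,
    so they contribute at most the order of 1/n. *)
Lemma hankel_kernel_gauss_limit z theta h : PI / 2 < theta <= PI -> is_hankel (hankel_kernel z) 0 theta h ->
  exists A, forall n, (1 <= n)%nat -> exists X,
    h = (rising z (S n) / (INR (fact n) * Cexp (z * ln (INR n))) * X)%C /\
    Cmod (X - 2 * PI * Ci) <= A * exp (- (ln (INR n) / 2)).
Proof.
  intros Hth Hh. pose proof PI_RGT_0.
  assert (c0 : 0 < - cos theta) by (pose proof (cos_lt_0 theta); lra).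
  destruct (exp_double_decay (- cos theta) (Cmod z) 0 c0) as [M HM].
  (* M2 bounds the rays; in A2 the factor 18 comes from [cos_upper] and
     [is_RInt_abs_gauss], and exp 1 from [stirling_upper] *)
  set (M2 := 2 * exp (Cmod z * PI) * M).
  set (A2 := Cmod z * exp (Cmod z * PI) * exp 1 * 18).
  exists (2 * M2 + A2). intros n Hn.
  destruct (hankel_kernel_integrable (z + INR (S n)) theta (ln (INR n)) Hth) as [l Hl].
  assert (P : 1 <= INR n) by (apply (le_INR 1); lia).
  assert (L : 0 <= ln (INR n)) by (rewrite <- ln_1; apply ln_le; lra).
  pose proof (INR_fact_neq_0_C n) as Nf. pose proof (Cexp_neq_0 (z * ln (INR n))) as Ne.
  exists (INR (fact n) * Cexp (z * ln (INR n)) * l)%C. split.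
  - assert (E : is_hankel (hankel_kernel z) 0 theta (rising z (S n) * l)%C).
    { apply hankel_kernel_rising; [assumption|]. now apply hankel_kernel_move with (ln (INR n)). }
    rewrite (is_hankel_unique _ _ _ _ _ Hh E). field. split; assumption.
  (* integrand of X - 2 PI i *)
  - set (G := fun v => (INR (fact n) * (hankel_kernel (INR (S n)) v * (Cexp (- z * (v - ln (INR n))) - 1)))%C).
    assert (HG : is_hankel G (ln (INR n)) theta (INR (fact n) * Cexp (z * ln (INR n)) * l - 2 * PI * Ci)%C).
    { assert (H1 := is_hankel_Cmult (INR (fact n) * Cexp (z * ln (INR n)))%C _ _ _ _ Hl).
      assert (H2 := is_hankel_Cmult (- INR (fact n))%C _ _ _ _ (hankel_kernel_nat n theta (ln (INR n)) Hth)).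
      (* H2 is the case z = 0, where the value 2 PI i is exact *)
      assert (H3 := is_hankel_plus _ _ _ _ _ _ H1 H2).
      replace (- INR (fact n) * (2 * PI * Ci / INR (fact n)))%C with (- (2 * PI * Ci))%C in H3 by now field.
      revert H3. apply is_hankel_ext; [lra|]. intros v _. unfold G, hankel_kernel.
      replace (Cexp v + (1 - (z + INR (S n))) * v)%C
        with ((Cexp v + (1 - INR (S n)) * v) + - z * v)%C by ring.
      replace (- z * (v - ln (INR n)))%C with (- z * v + z * ln (INR n))%C by ring.
      rewrite !Cexp_plus. ring. }
    assert (CG : forall t y, Cmod (G (t, y)) =
      INR (fact n) * (exp (exp t * cos y - INR n * t) * Cmod (Cexp (- z * ((t, y) - ln (INR n))) - 1))).
    { intros t y. unfold G. rewrite !Cmod_mult, Cmod_R, Rabs_pos_eq by apply pos_INR.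
      rewrite Cmod_hankel_kernel. do 3 f_equal. rewrite S_INR. unfold Re, Im; simpl. ring. }
    assert (Rb : forall y, cos y = cos theta -> Rabs y <= PI -> forall t, ln (INR n) <= t -> Cmod (G (t, y)) <= M2 * exp (- t)).
    { intros y Hy Hy' t Ht. rewrite CG, Hy.
      assert (B1 : Cmod (Cexp (- z * ((t, y) - ln (INR n))) - 1) <= 2 * exp (Cmod z * (t + PI))).
      { replace (Cexp (- z * ((t, y) - ln (INR n))) - 1)%C with (Cexp (- z * ((t, y) - ln (INR n))) + - (1))%C by ring.
        eapply Rle_trans; [apply Cmod_triangle|]. rewrite Cmod_opp, Cmod_1.
        assert (0 <= Cmod z * (t + PI)) by (apply Rmult_le_pos; [apply Cmod_ge_0|lra]).
        assert (1 <= exp (Cmod z * (t + PI))) by (rewrite <- exp_0; now apply exp_le).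
        assert (Cmod (Cexp (- z * ((t, y) - ln (INR n)))) <= exp (Cmod z * (t + PI))); [|lra].
        rewrite Cmod_Cexp. apply exp_le.
        pose proof (Rmax_Cmod z) as Z. pose proof (Rmax_l (Rabs (fst z)) (Rabs (snd z))). pose proof (Rmax_r (Rabs (fst z)) (Rabs (snd z))).
        pose proof (Rle_abs (- fst z)) as Z4. rewrite Rabs_Ropp in Z4.
        unfold Re; simpl.
        assert (snd z * y <= Cmod z * PI).
        { eapply Rle_trans; [apply Rle_abs|]. rewrite Rabs_mult. apply Rmult_le_compat; try apply Rabs_pos; lra. }
        assert (- fst z * (t - ln (INR n)) <= Cmod z * t).
        { apply Rle_trans with (Cmod z * (t - ln (INR n))); [apply Rmult_le_compat_r; lra|].
          apply Rmult_le_compat_l; [apply Cmod_ge_0|lra]. }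
        lra. }
      assert (B2 : INR (fact n) * exp (exp t * cos theta - INR n * t) <= exp (- - cos theta * exp t)).
      { eapply Rle_trans; [apply Rmult_le_compat_r; [left; apply exp_pos|apply fact_le_pow; assumption]|].
        rewrite <- exp_plus. apply exp_le. pose proof (Rmult_le_compat_l (INR n) _ _ ltac:(lra) Ht). lra. }
      rewrite <- Rmult_assoc.
      eapply Rle_trans; [apply Rmult_le_compat; [apply Rmult_le_pos; [apply pos_INR|left; apply exp_pos]|apply Cmod_ge_0|apply B2|apply B1]|].
      unfold M2. specialize (HM t ltac:(lra)).
      replace (Cmod z * (t + PI)) with (Cmod z * t + Cmod z * PI) by ring.
      rewrite exp_plus. rewrite exp_plus in HM. pose proof (exp_pos (Cmod z * PI)).
      replace (- - cos theta * exp t) with (- (- cos theta) * exp t) by ring.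
      apply Rle_trans with (2 * exp (Cmod z * PI) * (exp (- (- cos theta) * exp t) * exp (Cmod z * t))); [right; ring|].
      rewrite (Rmult_assoc _ M). apply Rmult_le_compat_l; lra. }
    assert (k0 : 0 < INR n / 18) by lra.
    destruct (is_RInt_abs_gauss (INR n / 18) theta k0) as [B [HB1 HB2]]; [lra|].
    set (C1 := Cmod z * exp (Cmod z * PI) * exp (ln (INR n) / 2 + 1)).
    assert (Ab : forall y, - theta <= y <= theta -> Cmod (G (ln (INR n), y)) <= C1 * (Rabs y * exp (- (INR n / 18) * y ^ 2))).
    { intros y Hy. rewrite CG.
      assert (Ya : Rabs y <= PI) by (apply Rabs_le; lra).
      assert (B1 : Cmod (Cexp (- z * ((ln (INR n), y) - ln (INR n))) - 1) <= Cmod z * Rabs y * exp (Cmod z * PI)).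
      { replace (- z * ((ln (INR n), y) - ln (INR n)))%C with (- z * (y * Ci))%C
          by (apply injective_projections; simpl; ring).
        eapply Rle_trans; [apply Cmod_Cexp_minus_1_le|].
        rewrite !Cmod_mult, Cmod_opp, Cmod_R, Cmod_Ci, Rmult_1_r.
        apply Rmult_le_compat_l; [apply Rmult_le_pos; [apply Cmod_ge_0|apply Rabs_pos]|].
        apply exp_le, Rmult_le_compat_l; [apply Cmod_ge_0|assumption]. }
      assert (B2 : INR (fact n) * exp (exp (ln (INR n)) * cos y - INR n * ln (INR n)) <=
        exp (ln (INR n) / 2 + 1) * exp (- (INR n / 18) * y ^ 2)).
      { eapply Rle_trans; [apply Rmult_le_compat_r; [left; apply exp_pos|apply stirling_upper; assumption]|].
        rewrite <- !exp_plus. apply exp_le. rewrite exp_ln by lra.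
        pose proof (cos_upper y ltac:(lra)).
        assert (INR n * cos y <= INR n * (1 - y ^ 2 / 18)) by (apply Rmult_le_compat_l; lra).
        lra. }
      rewrite <- Rmult_assoc.
      eapply Rle_trans; [apply Rmult_le_compat; [apply Rmult_le_pos; [apply pos_INR|left; apply exp_pos]|apply Cmod_ge_0|apply B2|apply B1]|].
      unfold C1. right; ring. }
    assert (HB : is_RInt (fun y => C1 * (Rabs y * exp (- (INR n / 18) * y ^ 2))) (- theta) theta (C1 * B)).
    { apply (is_RInt_scal (V := R_NormedModule)). exact HB1. }
    eapply Rle_trans; [apply (hankel_bound_arc G (ln (INR n)) theta _ M2
       (fun y => C1 * (Rabs y * exp (- (INR n / 18) * y ^ 2))) (C1 * B) ltac:(lra)); [| |exact Ab|exact HB|exact HG]|].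
    + apply Rb; [reflexivity|rewrite Rabs_pos_eq; lra].
    + apply Rb; [apply cos_neg|rewrite Rabs_Ropp, Rabs_pos_eq; lra].
    + assert (M0 : 0 <= M2).
      { pose proof (Rb theta eq_refl ltac:(rewrite Rabs_pos_eq; lra) _ (Rle_refl _)) as Q.
        pose proof (Cmod_ge_0 (G (ln (INR n), theta))). pose proof (exp_pos (- ln (INR n))). nra. }
      rewrite Rmult_plus_distr_r. apply Rplus_le_compat.
      * apply Rmult_le_compat_l; [lra|]. apply exp_le; lra.
      * assert (0 <= C1).
        { unfold C1. apply Rmult_le_pos; [apply Rmult_le_pos; [apply Cmod_ge_0|]|]; left; apply exp_pos. }
        eapply Rle_trans; [apply Rmult_le_compat_l; [assumption|exact HB2]|].
        unfold C1, A2. right.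
        replace (/ (INR n / 18)) with (18 * exp (- ln (INR n))).
        -- replace (- (ln (INR n) / 2)) with (ln (INR n) / 2 + - ln (INR n)) by field.
           rewrite !exp_plus. ring.
        -- rewrite exp_Ropp, exp_ln by lra. field; lra.
Qed.

Definition Cseq_lim (u : nat -> C) (l : C) : Prop :=
  forall e, 0 < e -> exists N, forall n, (N <= n)%nat -> Cmod (u n - l) < e.

Lemma C_lim_seq_correct u l : Cseq_lim u l -> C_lim_seq u = l.
Proof.
  intro H.
  assert (A : is_lim_seq (fun n => Re (u n)) (Re l)).
  { apply is_lim_seq_spec. intros [e He]. destruct (H e He) as [N HN]. exists N. intros n Hn.
    eapply Rle_lt_trans; [|apply (HN n Hn)]. simpl.
    eapply Rle_trans; [|apply (Rmax_Cmod (u n - l)%C)]. simpl. apply Rmax_l. }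
  assert (B : is_lim_seq (fun n => Im (u n)) (Im l)).
  { apply is_lim_seq_spec. intros [e He]. destruct (H e He) as [N HN]. exists N. intros n Hn.
    eapply Rle_lt_trans; [|apply (HN n Hn)]. simpl.
    eapply Rle_trans; [|apply (Rmax_Cmod (u n - l)%C)]. simpl. apply Rmax_r. }
  unfold C_lim_seq. rewrite (is_lim_seq_unique _ _ A), (is_lim_seq_unique _ _ B).
  simpl. now destruct l.
Qed.

(** Hankel's formula. The left side h equals u_n X_n with u_n Gauss's sequence for
    1/Gamma and X_n tending to 2 pi i; this proves at once that u_n converges and
    identifies its limit. *)
Lemma hankel_rGamma w theta t0 : PI / 2 < theta <= PI -> is_hankel (hankel_kernel w) t0 theta (2 * PI * Ci * rGamma w)%C.
Proof.
  intro Hth. pose proof PI_RGT_0.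
  destruct (hankel_kernel_integrable w theta t0 Hth) as [h Hh].
  set (c := (2 * PI * Ci)%C).
  assert (Mc : Cmod c = 2 * PI).
  { unfold c. rewrite !Cmod_mult, Cmod_Ci, !Cmod_R, !Rabs_pos_eq by lra. ring. }
  assert (Nc : c <> 0) by (intro E; rewrite E, Cmod_0 in Mc; lra).
  replace (c * rGamma w)%C with h; [assumption|].
  cut (rGamma w = h / c)%C; [intros ->; now field|].
  destruct (hankel_kernel_gauss_limit w theta h Hth) as [A HA]; [now apply hankel_kernel_move with t0|].
  unfold rGamma. apply C_lim_seq_correct. intros e He.
  pose proof (Cmod_ge_0 h) as Ph.
  (* d <= PI keeps X away from 0: then |X| >= 2 PI - PI >= 1 *)
  set (d := Rmin PI (e / (Cmod h + 1))).
  assert (Pe : 0 < e / (Cmod h + 1)) by (apply Rdiv_lt_0_compat; lra).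
  assert (Pd : 0 < d) by (unfold d; apply Rmin_pos; lra).
  set (q := d / (Rabs A + 1)).
  assert (PA := Rabs_pos A).
  assert (Pq : 0 < q) by (unfold q; apply Rdiv_lt_0_compat; lra).
  destruct (INR_unbounded (exp (- (2 * ln q)))) as [N HN].
  exists (S N). intros n Hn.
  destruct (HA n ltac:(lia)) as [X [EX BX]].
  match goal with |- Cmod (?v - _) < _ => set (u := v) in * end.
  assert (Pn : INR N <= INR n) by (apply le_INR; lia).
  assert (Bq : exp (- (ln (INR n) / 2)) < q).
  { rewrite <- (exp_ln q) by assumption. apply exp_increasing.
    assert (- (2 * ln q) < ln (INR n)); [|lra].
    apply exp_lt_inv. rewrite exp_ln; [lra|]. pose proof (exp_pos (- (2 * ln q))); lra. }
  assert (Bd : Cmod (X - c) < d).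
  { eapply Rle_lt_trans; [exact BX|].
    pose proof (exp_pos (- (ln (INR n) / 2))). pose proof (Rle_abs A).
    apply Rle_lt_trans with (Rabs A * exp (- (ln (INR n) / 2))); [apply Rmult_le_compat_r; lra|].
    apply Rle_lt_trans with (Rabs A * q); [apply Rmult_le_compat_l; lra|].
    assert ((Rabs A + 1) * q = d) by (unfold q; field; lra). lra. }
  assert (d <= PI) by apply Rmin_l. assert (d <= e / (Cmod h + 1)) by apply Rmin_r.
  assert (MX : PI <= Cmod X).
  { assert (Cmod c <= Cmod X + Cmod (X - c)).
    { replace c with (X + - (X - c))%C at 1 by ring.
      eapply Rle_trans; [apply Cmod_triangle|]. rewrite Cmod_opp; lra. }
    lra. }
  assert (NX : X <> 0) by (intro E; rewrite E, Cmod_0 in MX; lra).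
  assert (Eu : (u - h / c = h * ((- (X - c)) * / (X * c)))%C).
  { rewrite EX. fold u. field. auto. }
  rewrite Eu, !Cmod_mult, Cmod_opp, Cmod_inv, Cmod_mult, Mc by now apply Cmult_neq_0.
  pose proof (Cmod_ge_0 (X - c)).
  assert (P1 : 1 <= PI) by (pose proof PI2_1; lra).
  assert (/ (Cmod X * (2 * PI)) <= 1).
  { rewrite <- Rinv_1. apply Rinv_le_contravar; nra. }
  assert (0 < / (Cmod X * (2 * PI))) by (apply Rinv_0_lt_compat; nra).
  apply Rle_lt_trans with (Cmod h * (Cmod (X - c) * 1)).
  - apply Rmult_le_compat_l; [assumption|]. apply Rmult_le_compat_l; lra.
  - rewrite Rmult_1_r. apply Rle_lt_trans with (Cmod h * (e / (Cmod h + 1))); [apply Rmult_le_compat_l; lra|].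
    assert ((Cmod h + 1) * (e / (Cmod h + 1)) = e) by (field; lra). lra.
Qed.

(** * Poles of the integrand *)

Lemma Rabs_Carg_Cexp w : Rabs (Im w) <= PI -> Rabs (Carg (Cexp w)) = Rabs (Im w).
Proof.
  intro H. unfold Carg. rewrite Cmod_Cexp.
  assert (E : Re (Cexp w) / exp (Re w) = cos (Rabs (Im w))).
  { assert (cos (Rabs (Im w)) = cos (Im w)) as ->.
    { unfold Rabs; destruct (Rcase_abs (Im w)); [apply cos_neg|reflexivity]. }
    unfold Cexp, Re at 1; simpl. field. pose proof (exp_pos (Re w)); lra. }
  rewrite E, acos_cos by (split; [apply Rabs_pos|assumption]).
  destruct (Rlt_dec (Im (Cexp w)) 0); rewrite ?Rabs_Ropp; apply Rabs_Rabsolu.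
Qed.

Lemma Rabs_Carg_le z : Rabs (Carg z) <= PI.
Proof.
  unfold Carg. pose proof (acos_bound (Re z / Cmod z)).
  destruct (Rlt_dec (Im z) 0); rewrite ?Rabs_Ropp, Rabs_pos_eq; lra.
Qed.

(** The ratio x / u^a of the geometric series, at u = e^v. *)
Definition geo_ratio (a : R) (x v : C) : C := (x * Cexp (- (a * v)))%C.

Lemma Cmod_geo_ratio a x t y : Cmod (geo_ratio a x (t, y)) = Cmod x * exp (- (a * t)).
Proof. unfold geo_ratio. rewrite Cmod_mult, Cmod_Cexp. do 2 f_equal. unfold Re; simpl; ring. Qed.

(** The contour can be pushed to the right without meeting a solution of
    u^a = x. Either |x| is smaller than |u^a| on the arc, hence further out too; or
    the argument of x exceeds that of every u^a in the sector, whatever the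
    radius. In both cases a little room [lo < t] is left. *)
Lemma Omega_minus_pole_free a x t theta : 0 < a -> 
  Omega_minus (exp (a * t)) (a * theta) x ->
  exists lo, lo < t /\ forall s y, lo < s -> - theta <= y <= theta -> (1 - geo_ratio a x (s, y))%C <> 0.
Proof.
  intros Ha [H|[H1 H2]].
  - assert (S : exists lo, lo < t /\ forall s, lo < s -> Cmod x < exp (a * s)).
    { destruct (Rle_lt_or_eq_dec _ _ (Cmod_ge_0 x)) as [P|P].
      - exists (ln (Cmod x) / a). split.
        + apply Rmult_lt_reg_l with a; [assumption|]. replace (a * (ln (Cmod x) / a)) with (ln (Cmod x)) by (field; lra).
          apply exp_lt_inv. now rewrite exp_ln.
        + intros s Hs. rewrite <- (exp_ln (Cmod x)) by assumption. apply exp_increasing.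
          apply Rmult_lt_compat_l with (r := a) in Hs; [|assumption].
          replace (a * (ln (Cmod x) / a)) with (ln (Cmod x)) in Hs by (field; lra). exact Hs.
      - exists (t - 1). split; [lra|]. intros s _. rewrite <- P. apply exp_pos. }
    destruct S as [lo [L S]]. exists lo; split; [assumption|]. intros s y Hs _ E.
    assert (Cmod (geo_ratio a x (s, y)) = 1).
    { replace (geo_ratio a x (s, y)) with (1 - (1 - geo_ratio a x (s, y)))%C by ring. rewrite E.
      replace (1 - 0)%C with (RtoC 1) by ring. apply Cmod_1. }
    rewrite Cmod_geo_ratio in H0. specialize (S s Hs).
    assert (exp (a * s) * exp (- (a * s)) = 1) by (rewrite <- exp_plus, Rplus_opp_r; apply exp_0).
    pose proof (exp_pos (- (a * s))). nra.
  - exists (t - 1). split; [lra|]. intros s y _ Hy E.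
    assert (X : x = Cexp (a * (s, y))).
    { transitivity (geo_ratio a x (s, y) * Cexp (a * (s, y)))%C.
      - unfold geo_ratio. rewrite Cexp_opp. field. apply Cexp_neq_0.
      - replace (geo_ratio a x (s, y)) with (1 - (1 - geo_ratio a x (s, y)))%C by ring. rewrite E. ring. }
    pose proof (Rabs_Carg_le x).
    assert (I : Im (a * (s, y))%C = a * y) by (unfold Im; simpl; ring).
    assert (Ay : Rabs (a * y) <= a * theta).
    { rewrite Rabs_mult, (Rabs_pos_eq a) by lra. apply Rmult_le_compat_l; [lra|]. apply Rabs_le; lra. }
    rewrite X, Rabs_Carg_Cexp, I in H2; [lra|]. rewrite <- X in H2. rewrite I; lra.
Qed.

Lemma holo_geo_ratio a x v : holo (geo_ratio a x) v.
Proof.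
  unfold geo_ratio. apply (holo_mult (fun _ => x) (fun v => Cexp (- (a * v)))); [apply holo_const|].
  apply holo_Cexp. apply (holo_ext (fun v => - a * v)%C); [intro; ring|].
  apply (holo_mult (fun _ => (- a)%C) (fun v => v)); [apply holo_const|apply holo_id].
Qed.

(** The integrand of the contour integral after the substitution
    s = u^(alpha beta gamma), u = e^v, with u^(alpha + beta + gamma) absorbed by the
    three denominators. *)
Definition MLkernel (alpha beta gamma : R) (x y z mu v : C) : C :=
  (hankel_kernel mu v / ((1 - geo_ratio alpha x v) * (1 - geo_ratio beta y v) * (1 - geo_ratio gamma z v)))%C.

Lemma holo_one_minus_geo_ratio a x v : holo (fun v => 1 - geo_ratio a x v)%C v.
Proof.
  apply (holo_ext (fun v => 1 + - (1) * geo_ratio a x v)%C); [intro; ring|].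
  apply (holo_plus (fun _ => 1%C)); [apply holo_const|].
  apply (holo_mult (fun _ => (- (1))%C)); [apply holo_const|apply holo_geo_ratio].
Qed.

Lemma holo_MLkernel alpha beta gamma x y z mu v :
  (1 - geo_ratio alpha x v)%C <> 0 -> (1 - geo_ratio beta y v)%C <> 0 -> (1 - geo_ratio gamma z v)%C <> 0 ->
  holo (MLkernel alpha beta gamma x y z mu) v.
Proof.
  intros Nx Ny Nz. unfold MLkernel, Cdiv.
  apply (holo_mult (hankel_kernel mu)); [apply holo_hankel_kernel|].
  apply (holo_Cinv (fun v => (1 - geo_ratio alpha x v) * (1 - geo_ratio beta y v) * (1 - geo_ratio gamma z v))%C).
  - apply (holo_mult (fun v => (1 - geo_ratio alpha x v) * (1 - geo_ratio beta y v))%C); [|apply holo_one_minus_geo_ratio].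
    apply (holo_mult (fun v => (1 - geo_ratio alpha x v))%C); apply holo_one_minus_geo_ratio.
  - repeat apply Cmult_neq_0; assumption.
Qed.

Definition ratio_small (a : R) (x : C) (t0 : R) : Prop :=
  forall t, t0 <= t -> Cmod x * exp (- (a * t)) <= / 2.

Lemma ratio_small_exists a x : 0 < a -> exists T, ratio_small a x T.
Proof.
  intro Ha. pose proof (Cmod_ge_0 x). assert (P : 0 < 2 * Cmod x + 1) by lra.
  exists (ln (2 * Cmod x + 1) / a). intros t Ht.
  apply Rmult_le_compat_l with (r := a) in Ht; [|lra].
  replace (a * (ln (2 * Cmod x + 1) / a)) with (ln (2 * Cmod x + 1)) in Ht by (field; lra).
  apply exp_le in Ht. rewrite exp_ln in Ht by assumption.
  rewrite exp_Ropp. apply Rmult_le_reg_r with (exp (a * t)); [apply exp_pos|].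
  rewrite Rmult_assoc, Rinv_l; [lra|]. pose proof (exp_pos (a * t)); lra.
Qed.

(** * Expansion into a triple geometric series *)

(** The Hankel integrand of a general term is the one of [mu] times a monomial in
    u^(-alpha), u^(-beta), u^(-gamma); hence the triple series is geometric under the
    integral sign. *)
Lemma hankel_kernel_shift alpha beta gamma mu n m p v :
  hankel_kernel (INR n * alpha + INR m * beta + INR p * gamma + mu) v =
  (hankel_kernel mu v * (Cexp (- (alpha * v)) ^ n * Cexp (- (beta * v)) ^ m * Cexp (- (gamma * v)) ^ p))%C.
Proof.
  unfold hankel_kernel. rewrite <- !Cexp_INR, <- !Cexp_plus. f_equal. ring.
Qed.

Lemma sum_n_C_S (u : nat -> C) N : @eq C (sum_n u (S N)) (sum_n u N + u (S N))%C.
Proof. apply (sum_Sn u N). Qed.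

Lemma sum_n_C_mult_l (k : C) (u : nat -> C) N : @eq C (sum_n (fun n => k * u n)%C N) (k * sum_n u N)%C.
Proof. apply (sum_n_mult_l (K := C_Ring)). Qed.

Lemma sum_n_C_mult_r (k : C) (u : nat -> C) N : @eq C (sum_n (fun n => u n * k)%C N) (sum_n u N * k)%C.
Proof. apply (sum_n_mult_r (K := C_Ring)). Qed.

Lemma cube_sum_C_ext (a b : nat -> nat -> nat -> C) N :
  (forall n m p, a n m p = b n m p) -> @eq C (cube_sum a N) (cube_sum b N).
Proof.
  intro H. unfold cube_sum. apply sum_n_ext; intro n. apply sum_n_ext; intro m. apply sum_n_ext; intro p. apply H.
Qed.

Lemma cube_sum_C_prod (k : C) (a b c : nat -> C) N :
  @eq C (cube_sum (fun n m p => k * (a n * b m * c p))%C N)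
  (k * (sum_n a N * sum_n b N * sum_n c N))%C.
Proof.
  unfold cube_sum.
  transitivity (sum_n (fun n => k * a n * (sum_n b N * sum_n c N))%C N).
  - apply sum_n_ext; intro n.
    transitivity (sum_n (fun m => k * a n * b m * (sum_n c N))%C N).
    + apply sum_n_ext; intro m. rewrite <- sum_n_C_mult_l. apply sum_n_ext; intro p. 
      match goal with |- ?a = ?b => change (@eq C a b) end. ring.
    + rewrite sum_n_C_mult_r. rewrite sum_n_C_mult_l. 
      match goal with |- ?a = ?b => change (@eq C a b) end. ring.
  - rewrite sum_n_C_mult_r, sum_n_C_mult_l. ring.
Qed.

Lemma sum_geo (q : C) N : (@eq C ((1 - q) * sum_n (fun n => q ^ n) N) (1 - q ^ (S N)))%C.
Proof.
  induction N as [|N IH].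
  - rewrite sum_O. simpl. ring.
  - rewrite sum_n_C_S, Cmult_plus_distr_l, IH, (Cpow_S q (S N)). ring.
Qed.

Lemma Cmult_div_cancel (a s : C) : a <> 0 -> s = (a * s / a)%C.
Proof. intro; now field. Qed.

Lemma is_hankel_sum_n (f : nat -> C -> C) (l : nat -> C) t0 theta N :
  (forall n, is_hankel (f n) t0 theta (l n)) -> 0 <= theta ->
  is_hankel (fun v => sum_n (fun n => f n v) N) t0 theta (sum_n l N).
Proof.
  intros H Ht. induction N as [|N IH].
  - rewrite sum_O. eapply is_hankel_ext; [assumption| |apply (H 0%nat)]. intros v _. now rewrite sum_O.
  - rewrite sum_n_C_S. eapply is_hankel_ext; [assumption| |apply (is_hankel_plus _ _ _ _ _ _ IH (H (S N)))].
    intros v _. now rewrite sum_n_C_S.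
Qed.

Lemma is_hankel_cube_sum (f : nat -> nat -> nat -> C -> C) (l : nat -> nat -> nat -> C) t0 theta N :
  (forall n m p, is_hankel (f n m p) t0 theta (l n m p)) -> 0 <= theta ->
  is_hankel (fun v => cube_sum (fun n m p => f n m p v) N) t0 theta (cube_sum l N).
Proof.
  intros H Ht. unfold cube_sum. 
  apply (is_hankel_sum_n (fun n v => sum_n (fun m => sum_n (fun p => f n m p v) N) N)); [|assumption]. intro n.
  apply (is_hankel_sum_n (fun m v => sum_n (fun p => f n m p v) N)); [|assumption]. intro m.
  apply (is_hankel_sum_n (fun p v => f n m p v)); [|assumption]. intro p. apply H.
Qed.

Lemma Cmod_pow (q : C) n : Cmod (q ^ n)%C = Cmod q ^ n.
Proof. induction n as [|n IH]; [apply Cmod_1|]. rewrite Cpow_S, Cmod_mult, IH. reflexivity. Qed.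

Lemma sum_half_le N : sum_n (fun n => (/ 2) ^ n) N <= 2.
Proof.
  assert (H : sum_n (fun n => (/ 2) ^ n) N = 2 - (/ 2) ^ N).
  { induction N as [|N IH]; [rewrite sum_O; simpl; lra|].
    rewrite sum_Sn, IH. unfold plus; simpl. lra. }
  rewrite H. pose proof (pow_le (/ 2) N ltac:(lra)). lra.
Qed.

Lemma cube_sum_half_le k (a : nat -> nat -> nat -> R) N : 0 <= k ->
  (forall n m p, a n m p <= k * ((/ 2) ^ n * (/ 2) ^ m * (/ 2) ^ p)) -> cube_sum a N <= 8 * k.
Proof.
  intros Hk H. unfold cube_sum.
  assert (P := sum_half_le N).
  assert (Pp : forall n, 0 <= (/ 2) ^ n) by (intro; apply pow_le; lra).
  assert (S : forall (u : nat -> R) c, 0 <= c -> (forall n, u n <= c * (/ 2) ^ n) -> sum_n u N <= 2 * c).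
  { intros u c Hc Hu. apply Rle_trans with (sum_n (fun n => c * (/ 2) ^ n) N).
    - apply sum_n_m_le. exact Hu.
    - assert (E : sum_n (fun n => c * (/ 2) ^ n) N = c * sum_n (fun n => (/ 2) ^ n) N)
        by apply (sum_n_mult_l (K := R_Ring)).
      rewrite E. nra. }
  replace (8 * k) with (2 * (4 * k)) by ring. apply S; [lra|]. intro n.
  replace (4 * k * (/ 2) ^ n) with (2 * (2 * k * (/ 2) ^ n)) by ring.
  apply S; [specialize (Pp n); nra|]. intro m.
  replace (2 * k * (/ 2) ^ n * (/ 2) ^ m) with (2 * (k * (/ 2) ^ n * (/ 2) ^ m)) by ring.
  apply S; [repeat apply Rmult_le_pos; auto|]. intro p.
  eapply Rle_trans; [apply H|]. right; ring.
Qed.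

(** Relative error of a product of three truncated geometric series. *)
Lemma Cmod_prod_1m a b c r : r <= 1 -> Cmod a <= r -> Cmod b <= r -> Cmod c <= r ->
  Cmod (1 - (1 - a) * (1 - b) * (1 - c)) <= 7 * r.
Proof.
  intros Hr Ha Hb Hc.
  pose proof (Cmod_ge_0 a). pose proof (Cmod_ge_0 b). pose proof (Cmod_ge_0 c).
  assert (B : forall w, Cmod w <= r -> Cmod (1 - w) <= 2).
  { intros w Hw. eapply Rle_trans; [apply Cmod_triangle|]. rewrite Cmod_opp, Cmod_1; lra. }
  replace (1 - (1 - a) * (1 - b) * (1 - c))%C with (a + ((1 - a) * b + (1 - a) * (1 - b) * c))%C by ring.
  eapply Rle_trans; [apply Cmod_triangle|].
  eapply Rle_trans; [apply Rplus_le_compat_l, Cmod_triangle|].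
  rewrite !Cmod_mult. pose proof (B a Ha). pose proof (B b Hb).
  pose proof (Cmod_ge_0 (1 - a)). pose proof (Cmod_ge_0 (1 - b)).
  assert (Cmod (1 - a) * Cmod b <= 2 * r) by (apply Rmult_le_compat; lra).
  assert (Cmod (1 - a) * Cmod (1 - b) <= 2 * 2) by (apply Rmult_le_compat; lra).
  assert (Cmod (1 - a) * Cmod (1 - b) * Cmod c <= 4 * r) by (apply Rmult_le_compat; try lra; apply Rmult_le_pos; lra).
  lra.
Qed.

Lemma Cmod_inv_1m q : Cmod q <= / 2 -> Cmod (/ (1 - q)) <= 2 /\ (1 - q)%C <> 0.
Proof.
  intro H.
  assert (L : / 2 <= Cmod (1 - q)).
  { assert (Cmod 1 <= Cmod (1 - q) + Cmod q).
    { replace (RtoC 1) with ((1 - q) + q)%C at 1 by ring. apply Cmod_triangle. }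
    rewrite Cmod_1 in H0. lra. }
  assert (N : (1 - q)%C <> 0) by (intro E; rewrite E, Cmod_0 in L; lra).
  split; [|assumption]. rewrite Cmod_inv by assumption.
  rewrite <- (Rinv_inv 2). apply Rinv_le_contravar; lra.
Qed.

Lemma on_path_ge t0 theta v : on_path t0 theta v -> t0 <= Re v.
Proof. intros [[H _]|[H _]]; lra. Qed.

(** Estimate 1/Gamma by Hankel's formula on the contour of abscissa [t0]: there
    the integrand for the index (n, m, p) is at most the one for [mu] times
    e^(- (n alpha + m beta + p gamma) t0), and these factors beat x^n y^m z^p. *)
Lemma ML3_term_bound (alpha beta gamma theta : R) (x y z mu : C) (t0 : R) :
  0 < alpha -> 0 < beta -> 0 < gamma -> PI / 2 < theta <= PI ->
  ratio_small alpha x t0 -> ratio_small beta y t0 -> ratio_small gamma z t0 ->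
  exists B, 0 <= B /\ forall n m p,
  Cmod (ML3_term alpha beta gamma x y z mu n m p) <= B * ((/ 2) ^ n * (/ 2) ^ m * (/ 2) ^ p).
Proof.
  intros Ha Hb Hg Hth Hx Hy Hz.
  pose proof PI_RGT_0. assert (P1 : 1 <= PI) by (pose proof PI2_1; lra).
  destruct (hankel_kernel_path_bound mu theta t0 Hth) as [M HM].
  assert (M0 : 0 <= M).
  { pose proof (HM (t0, theta) ltac:(right; simpl; lra)). pose proof (Cmod_ge_0 (hankel_kernel mu (t0, theta))).
    simpl in *. pose proof (exp_pos (- t0)). nra. }
  assert (B0 : 0 <= (2 + 2 * theta) * (M * exp (- t0))).
  { apply Rmult_le_pos; [lra|]. apply Rmult_le_pos; [assumption|left; apply exp_pos]. }
  exists ((2 + 2 * theta) * (M * exp (- t0))). split; [assumption|]. intros n m p.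
  set (w := (INR n * alpha + INR m * beta + INR p * gamma + mu)%C).
  set (E := exp (- (alpha * t0)) ^ n * exp (- (beta * t0)) ^ m * exp (- (gamma * t0)) ^ p).
  assert (Hdec : forall a v k, 0 < a -> t0 <= Re v -> 0 <= Cmod (Cexp (- (a * v)) ^ k) <= exp (- (a * t0)) ^ k).
  { intros a v k Pa Hv. split; [apply Cmod_ge_0|]. rewrite Cmod_pow, Cmod_Cexp. apply pow_incr. split; [left; apply exp_pos|].
    apply exp_le. unfold Re in *; simpl. nra. }
  assert (H1 : Cmod (2 * PI * Ci * rGamma w) <= (2 + 2 * theta) * (M * E * exp (- t0))).
  { apply (hankel_bound (hankel_kernel w) t0 theta); [lra| |now apply hankel_rGamma].
    intros v Hv. unfold w. rewrite hankel_kernel_shift, !Cmod_mult. pose proof (on_path_ge _ _ v Hv) as Hv'.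
    replace (M * E * exp (- Re v)) with ((M * exp (- Re v)) * E) by ring.
    apply Rmult_le_compat; [apply Cmod_ge_0| |now apply HM|].
    - repeat apply Rmult_le_pos; apply Cmod_ge_0.
    - pose proof (Hdec alpha v n Ha Hv'). pose proof (Hdec beta v m Hb Hv'). pose proof (Hdec gamma v p Hg Hv').
      unfold E. apply Rmult_le_compat; try lra; [apply Rmult_le_pos; lra|]. apply Rmult_le_compat; lra. }
  assert (H2 : Cmod (rGamma w) <= (2 + 2 * theta) * (M * exp (- t0)) * E).
  { rewrite !Cmod_mult, Cmod_Ci, !Cmod_R, !Rabs_pos_eq in H1 by lra.
    pose proof (Cmod_ge_0 (rGamma w)). nra. }
  unfold ML3_term. fold w. rewrite !Cmod_mult, !Cmod_pow.
  eapply Rle_trans; [apply Rmult_le_compat_l; [repeat apply Rmult_le_pos; apply pow_le, Cmod_ge_0|exact H2]|].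
  set (B := (2 + 2 * theta) * (M * exp (- t0))) in *.
  replace (Cmod x ^ n * Cmod y ^ m * Cmod z ^ p * (B * E)) with
    (B * ((Cmod x * exp (- (alpha * t0))) ^ n * (Cmod y * exp (- (beta * t0))) ^ m * (Cmod z * exp (- (gamma * t0))) ^ p))
    by (unfold E; rewrite !Rpow_mult_distr; ring).
  apply Rmult_le_compat_l; [assumption|].
  assert (Q : forall u a k, Cmod u * exp (- (a * t0)) <= / 2 -> 0 <= (Cmod u * exp (- (a * t0))) ^ k <= (/ 2) ^ k).
  { intros u a k Hu. assert (0 <= Cmod u * exp (- (a * t0))) by (apply Rmult_le_pos; [apply Cmod_ge_0|left; apply exp_pos]).
    split; [now apply pow_le|]. apply pow_incr. lra. }
  pose proof (Q x alpha n (Hx t0 (Rle_refl _))). pose proof (Q y beta m (Hy t0 (Rle_refl _))).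
  pose proof (Q z gamma p (Hz t0 (Rle_refl _))).
  apply Rmult_le_compat; try lra; [apply Rmult_le_pos; lra|]. apply Rmult_le_compat; lra.
Qed.

Lemma ML3_abs_summable (alpha beta gamma theta : R) (x y z mu : C) (t0 : R) :
  0 < alpha -> 0 < beta -> 0 < gamma -> PI / 2 < theta <= PI ->
  ratio_small alpha x t0 -> ratio_small beta y t0 -> ratio_small gamma z t0 ->
  abs_summable3 (ML3_term alpha beta gamma x y z mu).
Proof.
  intros Ha Hb Hg Hth Hx Hy Hz.
  destruct (ML3_term_bound alpha beta gamma theta x y z mu t0) as [B [B0 HB]]; try assumption. exists (8 * B). intro N. now apply cube_sum_half_le.
Qed.

Lemma geo_ratio_le_half a u t0 v : t0 <= Re v -> ratio_small a u t0 -> Cmod (geo_ratio a u v) <= / 2.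
Proof. intros Hv H. destruct v as [s r]. rewrite Cmod_geo_ratio. now apply H. Qed.

Lemma MLkernel_bound (alpha beta gamma theta : R) (x y z mu : C) (t0 : R) :
  PI / 2 < theta <= PI ->
  ratio_small alpha x t0 -> ratio_small beta y t0 -> ratio_small gamma z t0 ->
  exists M, forall v, on_path t0 theta v ->
  Cmod (MLkernel alpha beta gamma x y z mu v) <= M * exp (- Re v).
Proof.
  intros Hth Hx Hy Hz.
  destruct (hankel_kernel_path_bound mu theta t0 Hth) as [M HM]. exists (M * 8). intros v Hv.
  pose proof (on_path_ge _ _ v Hv) as Hv'.
  destruct (Cmod_inv_1m _ (geo_ratio_le_half alpha x t0 v Hv' Hx)) as [X1 X2].
  destruct (Cmod_inv_1m _ (geo_ratio_le_half beta y t0 v Hv' Hy)) as [Y1 Y2].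
  destruct (Cmod_inv_1m _ (geo_ratio_le_half gamma z t0 v Hv' Hz)) as [Z1 Z2].
  replace (MLkernel alpha beta gamma x y z mu v) with
    (hankel_kernel mu v * (/ (1 - geo_ratio alpha x v) * / (1 - geo_ratio beta y v) * / (1 - geo_ratio gamma z v)))%C
    by (unfold MLkernel; field; auto).
  rewrite !Cmod_mult. replace (M * 8 * exp (- Re v)) with ((M * exp (- Re v)) * 8) by ring.
  pose proof (Cmod_ge_0 (/ (1 - geo_ratio alpha x v))). pose proof (Cmod_ge_0 (/ (1 - geo_ratio beta y v))).
  pose proof (Cmod_ge_0 (/ (1 - geo_ratio gamma z v))).
  apply Rmult_le_compat; [apply Cmod_ge_0|repeat apply Rmult_le_pos; assumption|now apply HM|].
  replace 8 with (2 * 2 * 2) by ring.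
  apply Rmult_le_compat; try lra; [apply Rmult_le_pos; lra|]. apply Rmult_le_compat; lra.
Qed.

(** For a large radius the three ratios are at most 1/2, so the partial sums over
    cubes differ from [MLkernel] by a relative error 7/2^(N+1), uniformly on the
    contour; integrating gives the limit of the partial sums. *)
Lemma hankel_MLkernel (alpha beta gamma theta : R) (x y z mu : C) (t0 : R) :
  0 < alpha -> 0 < beta -> 0 < gamma -> PI / 2 < theta <= PI ->
  ratio_small alpha x t0 -> ratio_small beta y t0 -> ratio_small gamma z t0 ->
  is_hankel (MLkernel alpha beta gamma x y z mu) t0 theta
  (2 * PI * Ci * ML3 alpha beta gamma x y z mu)%C.
Proof.
  intros Ha Hb Hg Hth Hx Hy Hz.
  pose proof PI_RGT_0. assert (P1 : 1 <= PI) by (pose proof PI2_1; lra).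
  assert (NZ : forall v, on_path t0 theta v ->
    (1 - geo_ratio alpha x v)%C <> 0 /\ (1 - geo_ratio beta y v)%C <> 0 /\ (1 - geo_ratio gamma z v)%C <> 0).
  { intros v Hv. pose proof (on_path_ge _ _ v Hv) as Hv'.
    repeat split; apply Cmod_inv_1m; now apply geo_ratio_le_half with t0. }
  destruct (MLkernel_bound alpha beta gamma theta x y z mu t0) as [M HM]; try assumption.
  assert (M0 : 0 <= M).
  { pose proof (HM (t0, theta) ltac:(right; simpl; lra)). pose proof (Cmod_ge_0 (MLkernel alpha beta gamma x y z mu (t0, theta))).
    simpl in *. pose proof (exp_pos (- t0)). nra. }
  destruct (hankel_exists (MLkernel alpha beta gamma x y z mu) t0 theta M) as [l Hl]; [lra| |exact HM|].
  { intros v Hv. apply holo_continuous, holo_MLkernel; now apply NZ. }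
  set (c := (2 * PI * Ci)%C).
  assert (Mc : Cmod c = 2 * PI).
  { unfold c. rewrite !Cmod_mult, Cmod_Ci, !Cmod_R, !Rabs_pos_eq by lra. ring. }
  assert (Nc : c <> 0) by (intro E; rewrite E, Cmod_0 in Mc; lra).
  replace (c * ML3 alpha beta gamma x y z mu)%C with l; [assumption|].
  cut (ML3 alpha beta gamma x y z mu = l / c)%C; [intros ->; now field|].
  unfold ML3, sum3. apply C_lim_seq_correct.
  set (D := (2 + 2 * theta) * (M * 7 * exp (- t0))).
  assert (D0 : 0 <= D).
  { unfold D. repeat apply Rmult_le_pos; try lra. left; apply exp_pos. }
  assert (Bd : forall N, Cmod (cube_sum (ML3_term alpha beta gamma x y z mu) N - l / c) <= D * (/ 2) ^ (S N)).
  { intro N.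
    (* T is the integrand of one term, normalised so that its integral is the
       term itself *)
    set (T := fun n m p v => ((x ^ n * y ^ m * z ^ p / c) * hankel_kernel (INR n * alpha + INR m * beta + INR p * gamma + mu) v)%C).
    assert (HT : is_hankel (fun v => cube_sum (fun n m p => T n m p v) N) t0 theta
       (cube_sum (ML3_term alpha beta gamma x y z mu) N)).
    { apply is_hankel_cube_sum; [|lra]. intros n m p.
      assert (Q := is_hankel_Cmult (x ^ n * y ^ m * z ^ p / c)%C _ _ _ _
        (hankel_rGamma (INR n * alpha + INR m * beta + INR p * gamma + mu)%C theta t0 Hth)).
      fold c in Q. unfold ML3_term, T.
      match type of Q with is_hankel _ _ _ ?u => match goal with |- is_hankel _ _ _ ?w =>
        replace w with u by (now field) end end. exact Q. }
    assert (Hd := is_hankel_plus _ _ _ _ _ _ HT (is_hankel_Cmult (- / c)%C _ _ _ _ Hl)).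
    replace (cube_sum (ML3_term alpha beta gamma x y z mu) N - l / c)%C with
      (cube_sum (ML3_term alpha beta gamma x y z mu) N + - / c * l)%C by (unfold Cdiv; ring).
    unfold D. replace ((2 + 2 * theta) * (M * 7 * exp (- t0)) * (/ 2) ^ S N) with
      ((2 + 2 * theta) * (M * (7 * (/ 2) ^ S N) * exp (- t0))) by ring.
    refine (hankel_bound _ t0 theta _ _ _ _ Hd); [lra|]. intros v Hv.
    destruct (NZ v Hv) as (NX & NY & NZ'). pose proof (on_path_ge _ _ v Hv) as Hv'.
    set (q1 := geo_ratio alpha x v) in *. set (q2 := geo_ratio beta y v) in *. set (q3 := geo_ratio gamma z v) in *.
    assert (ET : cube_sum (fun n m p => T n m p v) N =
      (hankel_kernel mu v / c * (sum_n (fun n => q1 ^ n) N * sum_n (fun n => q2 ^ n) N * sum_n (fun n => q3 ^ n) N))%C).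
    { rewrite <- cube_sum_C_prod. apply cube_sum_C_ext. intros n m p. unfold T. rewrite hankel_kernel_shift.
      unfold q1, q2, q3, geo_ratio. rewrite !Cpow_mult_l. now field. }
    assert (EQ : forall q, (1 - q)%C <> 0 -> sum_n (fun n => q ^ n)%C N = ((1 - q ^ S N) / (1 - q))%C).
    { intros q Nq. rewrite <- sum_geo. now apply Cmult_div_cancel. }
    rewrite ET, !EQ by assumption.
    replace (hankel_kernel mu v / c * ((1 - q1 ^ S N) / (1 - q1) * ((1 - q2 ^ S N) / (1 - q2)) * ((1 - q3 ^ S N) / (1 - q3))) +
      - / c * MLkernel alpha beta gamma x y z mu v)%C with
      (- / c * (MLkernel alpha beta gamma x y z mu v * (1 - (1 - q1 ^ S N) * (1 - q2 ^ S N) * (1 - q3 ^ S N))))%C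
      by (unfold MLkernel; fold q1 q2 q3; field; auto).
    rewrite !Cmod_mult, Cmod_opp, Cmod_inv, Mc by assumption.
    assert (Hq : forall q, Cmod q <= / 2 -> Cmod (q ^ S N) <= (/ 2) ^ S N).
    { intros q Q. rewrite Cmod_pow. apply pow_incr. split; [apply Cmod_ge_0|assumption]. }
    assert (R1 : (/ 2) ^ S N <= 1) by (rewrite <- (pow1 (S N)); apply pow_incr; lra).
    pose proof (Cmod_prod_1m (q1 ^ S N) (q2 ^ S N) (q3 ^ S N) _ R1
      (Hq _ (geo_ratio_le_half alpha x t0 v Hv' Hx)) (Hq _ (geo_ratio_le_half beta y t0 v Hv' Hy)) (Hq _ (geo_ratio_le_half gamma z t0 v Hv' Hz))) as B7.
    assert (I1 : 0 <= / (2 * PI) <= 1).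
    { split; [left; apply Rinv_0_lt_compat; lra|]. rewrite <- Rinv_1. apply Rinv_le_contravar; lra. }
    replace (M * (7 * (/ 2) ^ S N) * exp (- Re v)) with (1 * ((M * exp (- Re v)) * (7 * (/ 2) ^ S N))) by ring.
    apply Rmult_le_compat; [lra| |lra|].
    - apply Rmult_le_pos; apply Cmod_ge_0.
    - apply Rmult_le_compat; [apply Cmod_ge_0|apply Cmod_ge_0|now apply HM|exact B7]. }
  intros e He.
  assert (Pd : 0 < e / (D + 1)) by (apply Rdiv_lt_0_compat; lra).
  destruct (pow_lt_1_zero (/ 2) ltac:(rewrite Rabs_pos_eq; lra) _ Pd) as [N HN].
  exists N. intros n Hn. eapply Rle_lt_trans; [apply Bd|].
  specialize (HN (S n) ltac:(lia)). rewrite Rabs_pos_eq in HN by (apply pow_le; lra).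
  apply Rle_lt_trans with (D * (e / (D + 1))); [apply Rmult_le_compat_l; lra|].
  assert ((D + 1) * (e / (D + 1)) = e) by (field; lra). lra.
Qed.

(** * From the contour in s to the logarithmic coordinate *)

Lemma polar_pow_log (r phi d : R) (a : C) : 0 < r -> 0 < d ->
  polar_pow r phi a = Cexp (a * d * ((ln r / d)%R, (phi / d)%R))%C.
Proof.
  intros Hr Hd. unfold polar_pow. f_equal. rewrite <- Cmult_assoc. f_equal.
  apply injective_projections; simpl; field; lra.
Qed.

(** Substitution r = e^(d t) in an integral over a ray of the contour. *)
Lemma is_ray_log (F f : R -> C) (d eps : R) l :
  0 < d -> 0 < eps ->
  (forall t, ln eps / d <= t -> continuous F t) ->
  (forall r, eps <= r -> (f r * r = F (ln r / d)%R)%C) ->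
  is_ray F (ln eps / d) l -> is_ray f eps (d * l)%C.
Proof.
  intros Hd He HC E (J & H1 & H2).
  assert (mon : forall r s, eps <= r -> r <= s -> ln r / d <= ln s / d).
  { intros r s Hr Hs. apply Rmult_le_compat_r; [left; now apply Rinv_0_lt_compat|]. apply ln_le; lra. }
  exists (fun T => d * J (ln T / d)%R)%C. split.
  - intros T HT.
    apply (is_RIntC_ext (fun r => d * (RtoC (/ (d * r)) * F (ln r / d)%R))%C); [assumption| |].
    + intros r Hr. rewrite <- E by lra. assert (d * r <> 0) by nra. rewrite RtoC_inv, RtoC_mult by assumption. field.
      split; apply RtoC_inj_neq; lra.
    + apply is_RIntC_Cmult.
      apply (is_RIntC_comp F (fun r => ln r / d) (fun r => / (d * r)) eps T); [assumption| | |].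
      * intros r Hr. apply HC. apply mon; lra.
      * intros r Hr. split; [auto_derive; [lra|field; lra]|].
        apply (ex_derive_continuous (V := R_NormedModule) (fun r => / (d * r))). auto_derive. nra.
      * apply H1. apply mon; lra.
  - apply tends_to_Cmult. intros e Pe. destruct (H2 e Pe) as [T0 HT0].
    exists (exp (d * T0)). intros T HT. apply HT0.
    pose proof (exp_pos (d * T0)).
    replace T0 with (ln (exp (d * T0)) / d) by (rewrite ln_exp; field; lra).
    apply Rmult_le_compat_r; [left; now apply Rinv_0_lt_compat|]. apply ln_le; lra.
Qed.

Lemma ML3_integrand_log (alpha beta gamma : R) (x y z mu : C) (d r phi : R) :
  0 < alpha -> 0 < beta -> 0 < gamma -> d = alpha * beta * gamma -> 0 < r ->
  let v : C := (ln r / d, phi / d) in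
  (1 - geo_ratio alpha x v)%C <> 0 -> (1 - geo_ratio beta y v)%C <> 0 -> (1 - geo_ratio gamma z v)%C <> 0 ->
  (ML3_integrand alpha beta gamma x y z mu r phi * Cexp (Ci * phi) * r)%C =
  MLkernel alpha beta gamma x y z mu v.
Proof.
  intros Ha Hb Hg Hd Hr v Nx Ny Nz.
  assert (d0 : 0 < d) by (rewrite Hd; repeat apply Rmult_lt_0_compat; assumption).
  assert (Ca : RtoC alpha <> 0) by (apply RtoC_inj_neq; lra).
  assert (Cb : RtoC beta <> 0) by (apply RtoC_inj_neq; lra).
  assert (Cg : RtoC gamma <> 0) by (apply RtoC_inj_neq; lra).
  assert (Cd : RtoC d = (alpha * beta * gamma)%C) by (rewrite Hd, !RtoC_mult; reflexivity).
  unfold ML3_integrand. rewrite !(polar_pow_log r phi d) by assumption. fold v. rewrite Cd.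
  replace (1 / (alpha * beta * gamma) * (alpha * beta * gamma) * v)%C with v by (field; auto).
  replace (1 / (beta * gamma) * (alpha * beta * gamma) * v)%C with (alpha * v)%C by (field; auto).
  replace (1 / (alpha * gamma) * (alpha * beta * gamma) * v)%C with (beta * v)%C by (field; auto).
  replace (1 / (alpha * beta) * (alpha * beta * gamma) * v)%C with (gamma * v)%C by (field; auto).
  assert (Er : RtoC r = Cexp (ln r)) by (rewrite Cexp_RtoC, exp_ln by assumption; reflexivity).
  assert (Ew : (Cexp (Ci * phi) * r = Cexp (alpha * beta * gamma * v))%C).
  { rewrite Er, <- Cexp_plus. f_equal. rewrite <- Cd. unfold v.
    apply injective_projections; simpl; field; lra. }
  assert (Ed : forall (a : R) (u : C), (Cexp (a * v) - u = Cexp (a * v) * (1 - geo_ratio a u v))%C).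
  { intros a u. unfold geo_ratio. rewrite Cexp_opp. field. apply Cexp_neq_0. }
  rewrite !Ed.
  replace (((alpha + beta + gamma + 1 - mu) / (alpha * beta * gamma) - 1) * (alpha * beta * gamma) * v)%C
    with (alpha * v + beta * v + gamma * v + (1 - mu) * v + - (alpha * beta * gamma * v))%C by (field; auto).
  rewrite !Cexp_plus, Cexp_opp, <- Ew.
  unfold MLkernel, hankel_kernel. rewrite Cexp_plus. field.
  repeat split; try assumption; try apply Cexp_neq_0.
  apply RtoC_inj_neq; lra.
Qed.
Theorem lemma3p1 (alpha beta gamma : R) (mu : C) (eps eta : R) (x y z : C)
  (Halpha : 0 < alpha < 2) (Hbeta : 0 < beta < 2) (Hgamma : 0 < gamma < 2)
  (Habg : alpha * beta * gamma < 2)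
  (Heps : 0 < eps)
  (Heta : PI * alpha * beta * gamma / 2 < eta <= Rmin PI (PI * alpha * beta * gamma))
  (Hx : Omega_minus (Rpower eps (1 / (beta * gamma))) (eta / (beta * gamma)) x)
  (Hy : Omega_minus (Rpower eps (1 / (alpha * gamma))) (eta / (alpha * gamma)) y)
  (Hz : Omega_minus (Rpower eps (1 / (alpha * beta))) (eta / (alpha * beta)) z) :
  abs_summable3 (ML3_term alpha beta gamma x y z mu) /\
  ex_omega_int eps eta (ML3_integrand alpha beta gamma x y z mu) /\
  ML3 alpha beta gamma x y z mu =
    (1 / (2 * PI * Ci) * (1 / (alpha * beta * gamma)) *
     omega_int eps eta (ML3_integrand alpha beta gamma x y z mu))%C.
Proof.
  pose proof PI_RGT_0 as Hpi.
  destruct Halpha as [Ha _]. destruct Hbeta as [Hb _]. destruct Hgamma as [Hg _].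
  remember (alpha * beta * gamma) as d eqn:Ed.
  assert (d0 : 0 < d) by (rewrite Ed; repeat apply Rmult_lt_0_compat; assumption).
  set (theta := eta / d). set (t0 := ln eps / d).
  assert (Het : eta = d * theta) by (unfold theta; field; lra).
  assert (Hth : PI / 2 < theta <= PI).
  { destruct Heta as [E1 E2]. pose proof (Rmin_r PI (PI * alpha * beta * gamma)) as E3.
    replace (PI * alpha * beta * gamma) with (PI * d) in * by (rewrite Ed; ring).
    split; [apply Rmult_lt_reg_l with d|apply Rmult_le_reg_l with d]; lra. }
  assert (Hlog : ln eps = d * t0) by (unfold t0; field; lra).
  unfold Rpower in Hx, Hy, Hz.
  replace (1 / (beta * gamma) * ln eps) with (alpha * t0) in Hx by (rewrite Hlog, Ed; field; lra).
  replace (1 / (alpha * gamma) * ln eps) with (beta * t0) in Hy by (rewrite Hlog, Ed; field; lra).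
  replace (1 / (alpha * beta) * ln eps) with (gamma * t0) in Hz by (rewrite Hlog, Ed; field; lra).
  replace (eta / (beta * gamma)) with (alpha * theta) in Hx by (rewrite Het, Ed; field; lra).
  replace (eta / (alpha * gamma)) with (beta * theta) in Hy by (rewrite Het, Ed; field; lra).
  replace (eta / (alpha * beta)) with (gamma * theta) in Hz by (rewrite Het, Ed; field; lra).
  destruct (Omega_minus_pole_free alpha x t0 theta Ha Hx) as [lx [Lx Nx]].
  destruct (Omega_minus_pole_free beta y t0 theta Hb Hy) as [ly [Ly Ny]].
  destruct (Omega_minus_pole_free gamma z t0 theta Hg Hz) as [lz [Lz Nz]].
  destruct (ratio_small_exists alpha x Ha) as [Tx Sx].
  destruct (ratio_small_exists beta y Hb) as [Ty Sy].
  destruct (ratio_small_exists gamma z Hg) as [Tz Sz].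
  (* t0 is the logarithmic radius of the given contour, t1 a radius at which
     the geometric series converge *)
  set (t1 := Rmax t0 (Rmax Tx (Rmax Ty Tz))).
  assert (t01 : t0 <= t1) by apply Rmax_l.
  assert (Hm : Rmax Tx (Rmax Ty Tz) <= t1) by apply Rmax_r.
  pose proof (Rmax_l Tx (Rmax Ty Tz)). pose proof (Rmax_r Tx (Rmax Ty Tz)).
  pose proof (Rmax_l Ty Tz). pose proof (Rmax_r Ty Tz).
  assert (Sx' : ratio_small alpha x t1) by (intros t Ht; apply Sx; lra).
  assert (Sy' : ratio_small beta y t1) by (intros t Ht; apply Sy; lra).
  assert (Sz' : ratio_small gamma z t1) by (intros t Ht; apply Sz; lra).
  split; [now apply (ML3_abs_summable alpha beta gamma theta x y z mu t1)|].
  set (lo := Rmax lx (Rmax ly lz)).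
  assert (Llo : lo < t0) by (unfold lo; repeat apply Rmax_lub_lt; assumption).
  pose proof (Rmax_l lx (Rmax ly lz)). pose proof (Rmax_r lx (Rmax ly lz)).
  pose proof (Rmax_l ly lz). pose proof (Rmax_r ly lz). fold lo in H3, H4.
  set (F := MLkernel alpha beta gamma x y z mu).
  assert (HF : forall s u, lo < s -> - theta <= u <= theta -> holo F (s, u)).
  { intros s u Hs Hu. apply holo_MLkernel; [apply Nx|apply Ny|apply Nz]; lra. }
  assert (HCF : forall s u, lo < s -> - theta <= u <= theta -> continuous F (s, u)).
  { intros; apply holo_continuous; now apply HF. }
  assert (HK : is_hankel F t1 theta (2 * PI * Ci * ML3 alpha beta gamma x y z mu)%C)
    by now apply hankel_MLkernel.
  apply (hankel_move F lo t0 t1 theta _ ltac:(lra) ltac:(lra) HF) in HK.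
  destruct HK as (a & b & c & A & B & D & E).
  set (f := ML3_integrand alpha beta gamma x y z mu).
  assert (Hf : forall r phi, eps <= r -> - eta <= phi <= eta ->
    (f r phi * Cexp (Ci * phi) * r)%C = F (ln r / d, phi / d)).
  { intros r phi Hr Hphi.
    assert (lo < ln r / d).
    { apply Rlt_le_trans with t0; [assumption|].
      apply Rmult_le_compat_r; [left; now apply Rinv_0_lt_compat|]. apply ln_le; lra. }
    assert (- theta <= phi / d <= theta).
    { split; apply Rmult_le_reg_l with d; try assumption; replace (d * (phi / d)) with phi by (field; lra); lra. }
    apply (ML3_integrand_log alpha beta gamma x y z mu d r phi Ha Hb Hg Ed ltac:(lra));
      [apply Nx|apply Ny|apply Nz]; lra. }
  assert (Eta0 : 0 <= eta) by (rewrite Het; apply Rmult_le_pos; lra).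
  assert (R1 : is_ray (ray_part f (- eta)) eps (d * a)%C).
  { apply (is_ray_log (fun t => F (t, - theta))); try assumption.
    - intros t Ht. apply continuous_hor, HCF; [apply Rlt_le_trans with t0; assumption|lra].
    - intros r Hr. unfold ray_part. rewrite Hf by lra. do 2 f_equal. unfold theta. field. lra. }
  assert (R2 : is_ray (ray_part f eta) eps (d * c)%C).
  { apply (is_ray_log (fun t => F (t, theta))); try assumption.
    - intros t Ht. apply continuous_hor, HCF; [apply Rlt_le_trans with t0; assumption|lra].
    - intros r Hr. unfold ray_part. rewrite Hf by lra. reflexivity. }
  assert (R3 : is_RIntC (arc_part f eps) (- eta) eta (Ci * (d * b))%C).
  { apply (is_RIntC_ext (fun phi : R => Ci * (d * (RtoC (/ d) * F (t0, (phi / d)%R))))%C); [lra| |].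
    - intros phi Hphi. unfold arc_part. fold t0 in Hf.
      assert (Q := Hf eps phi (Rle_refl _) Hphi). fold t0 in Q. rewrite <- Q. rewrite RtoC_inv by lra. field.
      apply RtoC_inj_neq; lra.
    - do 2 apply is_RIntC_Cmult.
      apply (is_RIntC_comp (fun u => F (t0, u)) (fun phi => phi / d) (fun _ => / d) (- eta) eta); [lra| | |].
      + intros phi Hphi. apply continuous_ver, HCF; [assumption|].
        split; apply Rmult_le_reg_l with d; try assumption; replace (d * (phi / d)) with phi by (field; lra); lra.
      + intros phi _. split; [auto_derive; [trivial|field; lra]|apply continuous_const].
      + replace (- eta / d) with (- theta) by (unfold theta; field; lra). exact B. }
  apply is_ray_RInt_gen in R1. apply is_ray_RInt_gen in R2.
  split.
  - split; [|split]; eexists; eassumption.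
  - unfold omega_int.
    rewrite (is_RInt_gen_unique (V := C_R_CompleteNormedModule) _ _ R1).
    rewrite (is_RInt_gen_unique (V := C_R_CompleteNormedModule) _ _ R2).
    rewrite (is_RInt_unique (V := C_R_CompleteNormedModule) _ _ _ _ R3).
    replace (- (d * a) + Ci * (d * b) + d * c)%C with (d * (2 * PI * Ci * ML3 alpha beta gamma x y z mu))%C
      by (rewrite E; ring).
    assert (Cd : RtoC d = (alpha * beta * gamma)%C) by (rewrite Ed, !RtoC_mult; reflexivity).
    rewrite Cd. field. 
    repeat split; try (apply RtoC_inj_neq; lra).
    intro Q. apply (f_equal snd) in Q. simpl in Q. lra.
Qed.
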